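(* Let $k\ge 1$ be an integer and let $G$ be a finite simple graph of order $n$ with $2k+2\le n\le 4k+1$. If $e(G)\ge \binom{2k+1}{2}+\binom{n-2k}{2}$, then $G$ contains cycles of every length $4,6,8,\dots,2k+2$, unless $G\cong K_1\vee(K_{2k}\cup K_{n-2k-1})$.
   Context: $e(G)$ is the number of edges of $G$. $K_m$ is the complete graph on $m$ vertices, $G_1\cup G_2$ the disjoint union, and $G_1\vee G_2$ the join (disjoint union together with all edges between $G_1$ and $G_2$). *)

(* Defs.v *)
(* A finite simple graph is a symmetric irreflexive
   relation e on a finType T. *)
From mathcomp Require Import ssreflect ssrfun ssrbool eqtype ssrnat seq choice fintype finset binomial.
Unset Printing Implicit Defensive.

Definition num_edges (T : finType) (e : rel T) : nat :=
  #|[set A : {set T} | [exists x, exists y, (A == [set x; y]) && e x y]]|.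

(* G contains a cycle of length l: l pairwise distinct vertices
   v_0, ..., v_{l-1} with v_i ~ v_{i+1 mod l}.  (Meaningful for l >= 3.) *)
Definition has_cycle (T : finType) (e : rel T) (l : nat) : Prop :=
  exists f : 'I_l -> T, injective f /\ forall i : 'I_l, e (f i) (f (ordS i)).

(* The graph K_1 \/ (K_{2k} u K_{n-2k-1}) on vertex set 'I_n:
   vertex 0 is the apex, vertices 1..2k form K_{2k},
   vertices 2k+1..n-1 form K_{n-2k-1}. *)
Definition extremal_rel (k n : nat) : rel 'I_n :=
  fun x y => (x != y) &&
    [|| nat_of_ord x == 0, nat_of_ord y == 0 | (x <= k.*2) == (y <= k.*2)].

Definition graph_iso (T : finType) (e : rel T) (n : nat) (e' : rel 'I_n) : Prop :=
  exists f : T -> 'I_n, bijective f /\ forall x y, e' (f x) (f y) = e x y.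

(* Main.v *)
(** Delete vertices of minimum degree as long as the edge count stays at its threshold;
    going back up, extending an extremal graph by one vertex again gives either an
    extremal graph or a cycle of length [2k+2]. There remains a graph on [n = 2k+d]
    vertices of minimum degree at least [d].

    It has a cycle of length at least [2k+2] and [2d] (or a spanning one): when the degrees
    are large this is a Dirac type argument on a longest path, whose two rotation
    sets would otherwise be separated by too many missing edges; when they are small,
    deleting further vertices down to [2k+2] and counting edges as in Chvatal's theorem
    gives a Hamiltonian subgraph.

    If [C] is a longest cycle, of length [L], and there is no cycle of length [2k+2], then
    Bondy's argument bounds twice the degree sum of [C] by [L^2], while each other vertex has at
    most [L/2] neighbours on [C]; this contradicts the edge count, except in the
    case [n = 4k] with all degrees at least [2k]. Shorter even cycles
    come from the same statement for smaller [k], completed for [n > 4k+1] by the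
    threshold [n^2 <= 4 e(G) + 1]. *)
Require Import Defs.
From mathcomp Require Import ssreflect ssrfun ssrbool eqtype ssrnat seq choice fintype finset binomial.
From mathcomp Require Import div path bigop zify.
From Stdlib Require Import Classical.

Set Implicit Arguments.
Unset Strict Implicit.
Unset Printing Implicit Defensive.

(** * Bounded maxima and counts on intervals *)

(** Paths and cycles range over an infinite type of sequences under [Prop] predicates, so maxima
    come from excluded middle and induction on the gap to the bound. *)
Lemma exists_maximal (S : Type) (P : S -> Prop) (f : S -> nat) (b : nat) :
  (exists x, P x) -> (forall x, P x -> f x <= b) ->
  exists2 x, P x & forall y, P y -> f y <= f x.
Proof.
move=> [x0 Px0] fb.
have [n le_n] := ubnP (b - f x0).
elim: n x0 Px0 le_n => // n IHn x0 Px0 le_n.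
case: (classic (exists2 y, P y & f x0 < f y)) => [[y Py lt_xy]|no].
  by apply: (IHn y Py); have := fb _ Py; lia.
exists x0 => // y Py; rewrite leqNgt; apply/negP => lt; apply: no.
by exists y.
Qed.

Section IntervalCounts.
Implicit Types p q : pred nat.

(** Position [x + u] is paired with [y + u], and each pair is hit at most once. The degree sums of
    path ends below are bounded by such pairings. *)
Lemma count_iota_disjoint p q x y c :
  (forall u, u < c -> ~~ (p (x + u) && q (y + u))) ->
  count p (iota x c) + count q (iota y c) <= c.
Proof.
elim: c x y => // c IHc x y H /=.
have := H 0 isT; rewrite !addn0.
have /IHc : forall u, u < c -> ~~ (p (x.+1 + u) && q (y.+1 + u)).
  by move=> u lt; have := H u.+1 lt; rewrite !addnS !addSn.
by case: (p x); case: (q y) => //=; lia.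
Qed.

Lemma count_iota0 p x c :
  (forall u, u < c -> ~~ p (x + u)) -> count p (iota x c) = 0.
Proof.
elim: c x => // c IHc x H /=.
have := H 0 isT; rewrite addn0 => /negbTE ->; rewrite IHc // => u lt.
by have := H u.+1 lt; rewrite addnS addSn.
Qed.

Lemma count_iotaD p x a b :
  count p (iota x (a + b)) = count p (iota x a) + count p (iota (x + a) b).
Proof. by rewrite iotaD count_cat. Qed.

(** A pair missed by both predicates lowers the bound by one; this serves the equality case of
    Bondy's count. *)
Lemma count_iota_disjoint_lt p q x y c u : u < c ->
  ~~ p (x + u) -> ~~ q (y + u) ->
  (forall v, v < c -> ~~ (p (x + v) && q (y + v))) ->
  count p (iota x c) + count q (iota y c) < c.
Proof.
move=> uc pu qu H.
have E : c = u + (1 + (c - u.+1)) by move: uc; clear; lia.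
have h1 : count p (iota x u) + count q (iota y u) <= u.
  by apply: count_iota_disjoint => v vu; apply: H; apply: ltn_trans vu uc.
have h2 : count p (iota (x + u + 1) (c - u.+1)) + count q (iota (y + u + 1) (c - u.+1)) <= c - u.+1.
  apply: count_iota_disjoint => v vu; rewrite -!addnA; apply: H.
  by move: vu uc; clear; lia.
rewrite {1 2}E !count_iotaD /= (negbTE pu) (negbTE qu).
by move: h1 h2 uc; clear; lia.
Qed.

End IntervalCounts.

Lemma count_nth (T : Type) (z : T) (p : pred T) (s : seq T) :
  count p s = count (fun i => p (nth z s i)) (iota 0 (size s)).
Proof. by rewrite -{1}(mkseq_nth z s) count_map; apply: eq_count. Qed.

(** * Arithmetic of the edge bounds *)

(** Used with [a = |X|], [b = |Y|] in [separated_vol]. The two brackets add up to at most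
    [2(n - t)]; with that value in their place both sides are equal. *)
Lemma separated_arith n t a b : t <= a -> t <= b -> a + b <= n -> n <= (a + b).+1 ->
  t.*2 < n ->
  (n - t.*2) * (n - t.*2).-1 +
  (t * (n.*2 - 1 - t - b.*2) + t * (n.*2 - 1 - t - a.*2)) +
  t.*2 * (n - 1 - t) <= n * n.-1.
Proof.
move=> ta tb abn nab tn.
rewrite -mulnDr.
have le1 : (n.*2 - 1 - t - b.*2) + (n.*2 - 1 - t - a.*2) <= 2 * (n - t) by lia.
have [N eN] : exists N, n = t.*2 + N.+1 by exists (n - t.*2 - 1); lia.
move: (leq_mul (leqnn t) le1) => {ta tb abn nab le1}.
set u := t * (_ + _); move: u => u; rewrite {}eN {tn}.
have -> : t.*2 + N.+1 - t = t + N.+1 by lia.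
have -> : t.*2 + N.+1 - t.*2 = N.+1 by lia.
have -> : t.*2 + N.+1 - 1 - t = t + N by lia.
rewrite addnS /= -!muln2; nia.
Qed.

Lemma no_long_cycle_arith1 k d h v x p r :
  k = h + (r + x) -> h = p.+2 -> d = r.+2 ->
  k.*2 * k.*2.+1 + d * d.-1 <= v ->
  v <= 2 * (h * h) + (h + (r + x).*2.+2) * (h + (r + x).*2.+1) + 2 * (h * r) + r * r.+1 ->
  False.
Proof.
move=> E1 E3 E4; rewrite E4 /= {d E4}; rewrite E1 E3 {E1 k E3 h} -!muln2.
by move: (leq0n (p * p)) (leq0n (p * r)) (leq0n (p * x)); clear; lia.
Qed.

Lemma no_long_cycle_arith2 k d h v x y p r :
  k = h + x -> k = d + y -> h = p.+2 -> d = r.+2 ->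
  k.*2 * k.*2.+1 + d * d.-1 <= v ->
  v + x * x.-1 <= 2 * (h * h) + (h + x.*2.+2) * (h + x.*2.+1) + 2 * (k * r) -> False.
Proof.
move=> E1 E2 E3 E4.
have Er : r + y = p + x by move: E1 E2 E3 E4; clear; lia.
rewrite E4 /= {E2 d E4}; rewrite E1 E3 {E1 k E3 h} -!muln2.
have hx : x * x = x * x.-1 + x by case: (x) => //= n; rewrite mulnS addnC.
move: hx (congr1 (muln r) Er) (congr1 (muln p) Er) (congr1 (muln x) Er).
move: (congr1 (muln y) Er) (leq0n (x * p)) (leq0n (y * y)).
by move: (x * x.-1) => xx; clear -Er; lia.
Qed.

(** Refutes the first alternative of [no_long_cycle_vol] at [j = d - 2]. The cases differ in whether
    the cap [k] on the deleted degrees is reached. *)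
Lemma no_long_cycle_arith k d h v : 1 < h <= k -> 1 < d <= k ->
  k.*2 * k.*2.+1 + d * d.-1 <= v ->
  v <= 2 * (h * h) + (k.*2.+2 - h) * (k.*2.+1 - h) + 2 * (h * (d - 2)) + (d - 2) * (d - 2).+1 ->
  (k <= h + (d - 2) -> v + (k - h) * (k - h).-1 <=
     2 * (h * h) + (k.*2.+2 - h) * (k.*2.+1 - h) + 2 * (k * (d - 2))) -> False.
Proof.
case/andP => h1 hk /andP[d1 dk] lo up1 up2.
have [p Eh] : exists p, h = p.+2 by exists (h - 2); move: h1; clear; lia.
have [r Ed] : exists r, d = r.+2 by exists (d - 2); move: d1; clear; lia.
have Ed2 : d - 2 = r by rewrite Ed; clear; lia.
rewrite Ed2 in up1 up2.
have [x Ek] : exists x, k = h + x by exists (k - h); move: hk; clear; lia.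
have E1 : k - h = x by move: Ek; clear; lia.
have E2 : k.*2.+2 - h = h + x.*2.+2 by move: Ek; clear; lia.
have E3 : k.*2.+1 - h = h + x.*2.+1 by move: Ek; clear; lia.
rewrite E1 E2 E3 in up1 up2.
have [le|lt] := leqP k (h + r).
  have [y Ey] : exists y, k = d + y by exists (k - d); move: dk; clear; lia.
  exact: no_long_cycle_arith2 Ek Ey Eh Ed lo (up2 le).
have [w Ew] : exists w, x = r + w by exists (x - r); move: lt Ek; clear; lia.
by rewrite Ew in Ek up1; exact: no_long_cycle_arith1 Ek Eh Ed lo up1.
Qed.

(** Refutes the second alternative of [no_long_cycle_vol] at [j = d - 2]. *)
Lemma large_core_arith k d i v : 0 < i <= d - 2 -> 1 < d <= k ->
  k.*2 * k.*2.+1 + d * d.-1 <= v ->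
  v + 2 * (k.+1 * (k + i)) <= (k.*2.+2 + i) * (k.*2.+1 + i) + 2 * (k * (d - 2 - i)) -> False.
Proof.
case/andP => i0 id /andP[d1 dk].
have [m Em] : exists m, d = i.+2 + m by exists (d - 2 - i); move: id d1; clear; lia.
have [q Eq] : exists q, k = d + q by exists (k - d); move: dk; clear; lia.
have -> : d - 2 - i = m by rewrite Em; clear; lia.
rewrite Eq Em /= {Eq k Em d d1 dk id} -!muln2.
move: (leq0n (m * m)) (leq0n (m * q)) (leq0n (q * q)) (leq0n (i * m)) (leq0n (i * q)).
by clear; lia.
Qed.

(** Contradicts the bound of [exact_length], with [r] vertices off the cycle. At [d = 2k], [L = 4k],
    [r = 0] the bounds agree, hence the strict [d < 2k]; that case is left to
    [half_degree_cycle]. *)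
Lemma exact_length_arith k d L r v : d < k.*2 -> d.*2 <= L -> k.*2 + d = L + r ->
  k.*2 * k.*2.+1 + d * d.-1 <= v ->
  v.*2 <= L * L + r * (L.*2 + r.-1.*2) -> False.
Proof.
move=> dk dL E lo up.
have [m Em] : exists m, k.*2 = d + m.+1 by exists (k.*2 - d).-1; move: dk; clear; lia.
have [u Eu] : exists u, L = d.*2 + u by exists (L - d.*2); move: dL; clear; lia.
have Er : m.+1 = u + r by move: E; rewrite Em Eu; clear; lia.
rewrite Em in lo; rewrite Eu in up.
have hr : r * r = r * r.-1 + r by case: (r) => //= n; rewrite mulnS addnC.
have hd : d * d = d * d.-1 + d by case: (d) => //= n; rewrite mulnS addnC.
have eup : r * ((d.*2 + u).*2 + r.-1.*2) = 2 * (r * (d.*2 + u)) + 2 * (r * r.-1).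
  by move: (r.-1) => p; rewrite -!muln2; clear; lia.
rewrite eup in up; move: hr hd lo up; rewrite -!muln2.
move: (r * r.-1) (d * d.-1) => r' d'.
move: (congr1 (muln r) Er) (congr1 (muln m) Er) (congr1 (muln u) Er) (congr1 (muln d) Er).
move: (leq0n (u * r)) (leq0n (u * u)).
by move: Er; clear; lia.
Qed.

(** Subtraction alone gives [(n - 1)^2 - 1 <= 2u + 1]; evenness of [u], a volume, supplies the
    missing unit. *)
Lemma delete_parity n v u t : ~~ odd u -> v = u + t.*2 -> t.*2 <= n -> 0 < n ->
  n * n <= v.*2.+1 -> n.-1 * n.-1 <= u.*2.+1.
Proof.
move=> /even_halfK <- ->; move: (u./2) => w {u}; rewrite -(odd_double_half n).
move: (n./2) => p; case: (odd n) => /=; rewrite ?add1n ?add0n -!muln2.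
  by clear; lia.
by case: p => // p; rewrite mulSn /=; clear; lia.
Qed.

(** * Degrees and volumes of induced subgraphs *)

Section Graph.
Variables (T : finType) (e : rel T).
Hypotheses (e_sym : symmetric e) (e_irr : irreflexive e).
Implicit Types (W C S : {set T}) (x y z : T) (s : seq T).

(** Subgraphs are induced and given by their vertex set; [x] may lie outside [W]. *)
Definition dg W x := #|[set y in W | e x y]|.
(** Twice the number of edges inside [W]. *)
Definition vol W := \sum_(x in W) dg W x.

Definition gpath W s := [/\ uniq s, {subset s <= W} & sorted e s].
(** The empty sequence and a single edge, of size 2, also qualify; the lengths sought are at least
    4. *)
Definition gcycle W s := [/\ uniq s, {subset s <= W} & cycle e s].

Lemma dgS C W x : C \subset W -> dg C x <= dg W x.
Proof.
move=> sCW; apply: subset_leq_card; apply/subsetP => y; rewrite !inE.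
by case/andP => yC ->; rewrite (subsetP sCW).
Qed.

Lemma dgU C W x : C \subset W -> dg W x = dg C x + dg (W :\: C) x.
Proof.
move=> sCW; rewrite /dg -cardsUI [X in _ = _ + X]eq_card0 ?addn0.
  apply: eq_card => y; rewrite !inE -andb_orl; case yC: (y \in C) => //=.
  by rewrite (subsetP sCW).
by move=> y; rewrite !inE; case: (y \in C); rewrite ?andbF.
Qed.

Lemma dg_le W x : dg W x <= #|W|.
Proof. by apply: subset_leq_card; apply/subsetP => y; rewrite inE => /andP[]. Qed.

Lemma dg_lt W x : x \in W -> dg W x < #|W|.
Proof.
move=> xW; rewrite (cardsD1 x W) xW ltnS; apply: subset_leq_card.
apply/subsetP => y; rewrite !inE => /andP[-> exy]; rewrite andbT.
by apply/eqP => E; move: exy; rewrite E e_irr.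
Qed.

Lemma dg_count W s x : uniq s -> W =i s -> dg W x = count (e x) s.
Proof.
move=> us Ws; rewrite /dg -size_filter -(card_uniqP _) ?filter_uniq //.
by apply: eq_card => y; rewrite !inE mem_filter Ws andbC.
Qed.

Lemma dg_le_count W s x : uniq s ->
  (forall y, y \in W -> e x y -> y \in s) -> dg W x <= count (e x) s.
Proof.
move=> us H; rewrite /dg -size_filter -(card_uniqP _) ?filter_uniq //.
apply: subset_leq_card; apply/subsetP => y; rewrite !inE mem_filter.
by case/andP => yW exy; rewrite exy H.
Qed.

Lemma sum_dg C S : \sum_(x in C) dg S x = \sum_(y in S) dg C y.
Proof.
have E A B : \sum_(x in A) dg B x = \sum_(x in A) \sum_(y in B) e x y.
  apply: eq_bigr => x _; rewrite /dg -sum1_card big_mkcond /= [RHS]big_mkcond.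
  by apply: eq_bigr => y _; rewrite inE; case: (y \in B); case: (e x y).
rewrite !E exchange_big /=; apply: eq_bigr => y _; apply: eq_bigr => x _.
by rewrite e_sym.
Qed.

(** An edge between [C] and the rest is counted at both ends; its end in [C] is charged to the outer
    vertex, as [dg C x]. *)
Lemma vol_split C W : C \subset W ->
  vol W = vol C + \sum_(x in W :\: C) (dg C x + dg W x).
Proof.
move=> sCW; rewrite /vol (big_setID C) /= (setIidPr sCW) big_split /= addnA.
congr (_ + _); rewrite [X in _ = _ + X]sum_dg -big_split /=.
by apply: eq_bigr => x _; rewrite (dgU _ sCW).
Qed.

Lemma vol_del W v : v \in W -> vol W = vol (W :\ v) + (dg W v).*2.
Proof.
move=> vW; rewrite (@vol_split (W :\ v)) ?subsetDl //; congr (_ + _).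
have -> : W :\: (W :\ v) = [set v].
  by apply/setP => y; rewrite !inE; case: eqP => [->|]; rewrite ?vW ?andbF //= andNb.
rewrite big_set1 -addnn; congr (_ + _); apply: eq_card => y; rewrite !inE.
by case: eqP => [->|] //=; rewrite e_irr andbF.
Qed.

Lemma vol_le W c : (forall x, x \in W -> dg W x <= c) -> vol W <= #|W| * c.
Proof. by move=> H; rewrite -sum_nat_const; apply: leq_sum. Qed.

Lemma vol_ge W c : (forall x, x \in W -> c <= dg W x) -> #|W| * c <= vol W.
Proof. by move=> H; rewrite -sum_nat_const; apply: leq_sum. Qed.

Lemma vol_le_complete W : vol W <= #|W| * (#|W|).-1.
Proof. by apply: vol_le => x /dg_lt; lia. Qed.

Lemma vol_split_le C W c : C \subset W ->
  (forall x, x \in W :\: C -> dg C x + dg W x <= c) ->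
  vol W <= vol C + (#|W| - #|C|) * c.
Proof.
move=> sCW H; rewrite (vol_split sCW) leq_add2l -(cardsDS sCW) -sum_nat_const.
exact: leq_sum.
Qed.

Lemma min_dg W : 0 < #|W| ->
  exists2 v, v \in W & forall x, x \in W -> dg W v <= dg W x.
Proof.
case/card_gt0P => w wW.
by case: (arg_minnP (dg W) wW) => v vW vmin; exists v.
Qed.

Lemma vol_even W : ~~ odd (vol W).
Proof.
have [n] := ubnP #|W|; elim: n W => // n IHn W le_n.
have [->|[v vW]] := set_0Vmem W; first by rewrite /vol big_set0.
rewrite (vol_del vW) oddD odd_double addbF IHn //.
by move: le_n; rewrite (cardsD1 v) vW; lia.
Qed.

(** * Cycles from crossing chords of a path *)

Lemma cycle_cat s1 s2 z : 0 < size s1 -> 0 < size s2 ->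
  sorted e s1 -> sorted e s2 ->
  e (last z s1) (head z s2) -> e (last z s2) (head z s1) -> cycle e (s1 ++ s2).
Proof.
case: s1 s2 => [|x1 p1] [|x2 p2] //= _ _ h1 h2 h12 h21.
by rewrite rcons_cat cat_path h1 /= h12 rcons_path h2.
Qed.


Lemma sorted_revE s : sorted e (rev s) = sorted e s.
Proof. by rewrite rev_sorted; case: s => //= x s; apply: eq_path => y z; rewrite e_sym. Qed.

Lemma gpath_rev W s : gpath W s -> gpath W (rev s).
Proof.
case=> us sW ps; split; rewrite ?rev_uniq ?sorted_revE //.
by move=> x; rewrite mem_rev; apply: sW.
Qed.

(** The cycle runs [0, ..., i], jumps to the last vertex, runs back to [j] and returns to [0]; only
    the vertices strictly between [i] and [j] are lost. *)
Lemma crossing_cycle W z s i j : gpath W s -> i < j -> j < size s ->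
  e (nth z s 0) (nth z s j) -> e (nth z s i) (nth z s (size s).-1) ->
  exists2 c, gcycle W c & size c = i.+1 + (size s - j) /\ {subset c <= s}.
Proof.
move=> [us sW ps] lt_ij lt_j e0j eil.
exists (take i.+1 s ++ rev (drop j s)); last first.
  split; first by rewrite size_cat size_take size_rev size_drop; case: ifP; lia.
  by move=> x; rewrite mem_cat mem_rev => /orP[/mem_take|/mem_drop].
have E : s = take i.+1 s ++ (drop i.+1 (take j s) ++ drop j s).
  rewrite catA -{1}(cat_take_drop j s); congr (_ ++ _).
  by rewrite -{1}(cat_take_drop i.+1 (take j s)) take_takel.
have sub : subseq (take i.+1 s ++ drop j s) s.
  rewrite [X in subseq _ X]E cat_subseq //; exact: suffix_subseq.
split.
- rewrite (perm_uniq (s2 := take i.+1 s ++ drop j s)).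
    exact: subseq_uniq sub us.
  by rewrite perm_cat2l perm_rev.
- move=> x; rewrite mem_cat mem_rev -mem_cat => /(mem_subseq sub); exact: sW.
apply: (cycle_cat (z := z)).
- by rewrite size_take; case: ifP; lia.
- by rewrite size_rev size_drop; lia.
- exact: take_sorted.
- by rewrite sorted_revE drop_sorted.
- rewrite -nth_last size_take; case: ifP => [lt|]; last lia.
  rewrite nth_take //= -nth0 nth_rev ?size_drop; last lia.
  rewrite nth_drop; have -> : j + (size s - j - 1) = (size s).-1 by lia.
  exact: eil.
- rewrite -nth_last size_rev size_drop nth_rev ?size_drop; last lia.
  rewrite nth_drop; have -> : j + (size s - j - (size s - j).-1.+1) = j by lia.
  by rewrite e_sym; case: (s) e0j lt_j => //=.
Qed.

(** Take a crossing pair of minimal gap [j - i]. If the gap is 1, the cycle spans the path.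
    Otherwise minimality keeps both neighbour sets out of the gap and forbids [a (u + 1)] together
    with [b u], so the degree sum is at most [i + 1 + (m - j)], the length of the cycle. *)
Lemma crossing_long_cycle W z s : gpath W s ->
  (exists i j, [/\ i < j, j < size s, e (nth z s 0) (nth z s j)
     & e (nth z s i) (nth z s (size s).-1)]) ->
  exists2 c, gcycle W c &
    minn (size s) (count (e (nth z s 0)) s + count (e (nth z s (size s).-1)) s)
      <= size c.
Proof.
move=> gs ex.
pose P (p : nat * nat) := [/\ p.1 < p.2, p.2 < size s,
  e (nth z s 0) (nth z s p.2) & e (nth z s p.1) (nth z s (size s).-1)].
have [|x|[i j] /= [/= lt_ij lt_j e0j eil] mx] :=
    @exists_maximal _ P (fun p => size s + p.1 - p.2) (size s).
- by case: ex => i [j H]; exists (i, j).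
- by case=> ? ? _ _; lia.
have [c gc [sc _]] := crossing_cycle gs lt_ij lt_j e0j eil.
exists c => //; rewrite sc.
have [->|gap] := eqVneq j i.+1; first by lia.
set m := size s in sc lt_j mx gap eil *.
rewrite geq_min; apply/orP; right.
rewrite !(count_nth z) -/m.
set a := fun i => e (nth z s 0) (nth z s i).
set b := fun i => e (nth z s m.-1) (nth z s i).
have noab u v : u < v -> v < m -> a v -> b u -> v - u >= j - i.
  move=> uv vm av bu; have := mx (u, v); rewrite /P /= => H.
  have := H _; rewrite -/(a v) av e_sym -/(b u) bu uv vm => H'.
  have := H' (And4 isT isT isT isT); lia.
have -> : count a (iota 0 m) = count a (iota 1 m.-1).
  have E : m = 1 + m.-1 by lia.
  have a0 : a 0 = false by exact: e_irr.
  by rewrite [in LHS]E count_iotaD /= a0.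
have -> : count b (iota 0 m) = count b (iota 0 m.-1).
  have E : m = m.-1 + 1 by lia.
  have bm : b m.-1 = false by exact: e_irr.
  by rewrite [in LHS]E count_iotaD /= add0n bm !addn0.
have -> : m.-1 = i.+1 + (j - i - 2 + (m - j)) by lia.
rewrite !count_iotaD.
have ha : count a (iota (1 + i.+1) (j - i - 2)) = 0.
  apply: count_iota0 => u lt; apply/negP => au.
  by have := noab i (1 + i.+1 + u); rewrite /b e_sym eil au; lia.
have hb : count b (iota (0 + i.+1) (j - i - 2)) = 0.
  apply: count_iota0 => u lt; apply/negP => bu.
  by have := noab (0 + i.+1 + u) j; rewrite {1}/a e0j bu; lia.
have h1 : count a (iota 1 i.+1) + count b (iota 0 i.+1) <= i.+1.
  apply: count_iota_disjoint => u lt; apply/negP => /andP[au bu].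
  by have := noab _ _ _ _ au bu; lia.
set x := 1 + i.+1 + _; set y := 0 + i.+1 + _.
have h2 : count a (iota x (m - j)) + count b (iota y (m - j)) <= m - j.
  apply: count_iota_disjoint => u lt; apply/negP => /andP[au bu].
  by have := noab _ _ _ _ au bu; lia.
rewrite ha hb; lia.
Qed.

(* By pigeonhole, two chords cross with consecutive feet. *)
Lemma crossing_spanning_cycle W z s : gpath W s -> 0 < size s ->
  size s <= count (e (nth z s 0)) s + count (e (nth z s (size s).-1)) s ->
  exists2 c, gcycle W c & perm_eq c s.
Proof.
move=> gs s0 big.
set m := size s in s0 big *.
set a := fun i => e (nth z s 0) (nth z s i).
set b := fun i => e (nth z s m.-1) (nth z s i).
have [|no] := boolP (has (fun u => a u.+1 && b u) (iota 0 m.-1)).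
  case/hasP => i; rewrite mem_iota => lt /andP[ai bi].
  have lt1 : i.+1 < size s by rewrite -/m; lia.
  have bi' : e (nth z s i) (nth z s (size s).-1) by rewrite e_sym.
  have [c gc [sc sub]] := crossing_cycle gs (ltnSn i) lt1 ai bi'.
  exists c => //; apply: uniq_perm; [by case: gc | by case: gs |].
  have [] := @uniq_min_size _ c s; [by case: gc| by [] | by rewrite sc -/m; lia|].
  by [].
move: big; rewrite !(count_nth z) -/m.
have -> : count (fun i => e (nth z s 0) (nth z s i)) (iota 0 m) = count a (iota 1 m.-1).
  have -> : m = 1 + m.-1 by lia.
  by rewrite count_iotaD /= e_irr.
have -> : count (fun i => e (nth z s m.-1) (nth z s i)) (iota 0 m) = count b (iota 0 m.-1).
  have E : m = m.-1 + 1 by lia.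
  by rewrite {2}E count_iotaD /= addn0 e_irr !addn0.
have := @count_iota_disjoint a b 1 0 m.-1 _.
suff H : forall u, u < m.-1 -> ~~ (a (1 + u) && b (0 + u)) by move/(_ H); lia.
move=> u lt; apply: contra no => h; apply/hasP; exists u => //.
by rewrite mem_iota; lia.
Qed.


(** * Longest paths and their rotations *)

Lemma subset_card S t : t <= #|S| -> exists2 A : {set T}, A \subset S & #|A| = t.
Proof.
move=> le; exists [set x in take t (enum S)].
  by apply/subsetP => x; rewrite inE => /mem_take; rewrite mem_enum.
rewrite cardsE; move/card_uniqP: (take_uniq t (enum_uniq S)) => ->.
by rewrite size_take -cardE; case: ltngtP le.
Qed.

Lemma mem_take_drop s i j x : uniq s -> i <= j -> x \in take i s -> x \in drop j s -> False.
Proof.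
move=> us ij xt xd; have := us; rewrite -(cat_take_drop i s) cat_uniq.
case/and3P => _ /hasP no _; apply: no; exists x => //.
by move: xd; rewrite -(subnKC ij) addnC -drop_drop => /mem_drop.
Qed.

Lemma in_take_nth z s k i : uniq s -> k < size s -> (nth z s k \in take i s) = (k < i).
Proof. by move=> us lt; rewrite in_take ?mem_nth // index_uniq. Qed.

Definition longest W s := gpath W s /\ forall s', gpath W s' -> size s' <= size s.

Lemma gpath_size W s : gpath W s -> size s <= #|W|.
Proof. by case=> us sW _; rewrite cardE; apply: uniq_leq_size => // x /sW; rewrite mem_enum. Qed.

Lemma exists_longest W : exists s, longest W s.
Proof.
have [||s gs mx] := @exists_maximal _ (gpath W) size #|W|.
- by exists [::]; split.
- exact: gpath_size.
by exists s.
Qed.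

Lemma longest_nonempty W s : 0 < #|W| -> longest W s -> 0 < size s.
Proof.
case/card_gt0P => w wW [_ /(_ [:: w])]; apply.
by split => // x; rewrite inE => /eqP ->.
Qed.

Lemma longest_rev W s : longest W s -> longest W (rev s).
Proof. by case=> gs mx; split; [exact: gpath_rev | rewrite size_rev]. Qed.

Lemma longest_closed W z s y : longest W s -> 0 < size s -> y \in W ->
  e (nth z s 0) y -> y \in s.
Proof.
case: s => // x s [[us sW ps] mx] _ yW /= exy; apply: contraT => ys.
have /mx /= : gpath W (y :: x :: s); last by rewrite ltnn.
split; rewrite ?cons_uniq ?ys //=; last by rewrite e_sym exy.
by move=> u; rewrite inE => /orP[/eqP -> //|/sW].
Qed.

Lemma longest_dg W z s : longest W s -> 0 < size s ->
  dg W (nth z s 0) <= count (e (nth z s 0)) s.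
Proof.
move=> ls s0; apply: dg_le_count; first by case: ls => -[].
by move=> y; apply: longest_closed.
Qed.

Lemma longest_dg_last W z s : longest W s -> 0 < size s ->
  dg W (nth z s (size s).-1) <= count (e (nth z s (size s).-1)) s.
Proof.
move=> ls s0; have := longest_dg z (longest_rev ls); rewrite size_rev => /(_ s0).
by rewrite nth_rev // subn1 count_rev.
Qed.

(** Otherwise the cycle, opened at [x] and extended by [y], would be a longer path. *)
Lemma longest_cycle_closed W s c x y : longest W s -> gcycle W c -> perm_eq c s ->
  x \in s -> y \in W -> e x y -> y \in s.
Proof.
move=> [gs mx] [uc cW cc] pcs; rewrite -!(perm_mem pcs) => xc yW exy.
apply: contraT => yc; have [i c' E] := rot_to xc.
have pc : perm_eq (x :: c') c by rewrite -E perm_rot.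
have /mx : gpath W (y :: x :: c').
  split.
  - by rewrite cons_uniq (perm_mem pc) yc (perm_uniq pc).
  - by move=> u; rewrite inE (perm_mem pc) => /orP[/eqP -> //|/cW].
  move: cc; rewrite -(rot_cycle i) E /= rcons_path (e_sym y) exy.
  by case/andP.
by rewrite /= -(perm_size pcs) -(perm_size pc) /= ltnn.
Qed.

(** Posa's rotation: the chord from [0] to [i] replaces the edge between [i - 1] and [i], and the
    vertex at [i - 1] becomes the head. *)
Lemma rotate_path W z s i : gpath W s -> 0 < i < size s ->
  e (nth z s 0) (nth z s i) -> gpath W (rev (take i s) ++ drop i s).
Proof.
move=> [us sW ps] /andP[i0 lt] e0i.
have E := cat_take_drop i s.
have pE : perm_eq (rev (take i s) ++ drop i s) s.
  by rewrite -[X in perm_eq _ X]E perm_cat2r perm_rev.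
split.
- by rewrite (perm_uniq pE).
- by move=> x; rewrite (perm_mem pE) => /sW.
have dE : drop i s = nth z s i :: drop i.+1 s by rewrite (drop_nth z).
have p1 : sorted e (drop i s) by apply: drop_sorted.
have p2 : sorted e (rev (take i s)) by rewrite sorted_revE take_sorted.
case: s i0 lt e0i {us sW ps E pE} dE p1 p2 => // x s.
case: i => // i _ lt /= e0i dE.
rewrite {}dE rev_cons => p1 p2.
have : sorted e (rcons (rev (take i s)) x) by [].
case: (rev _) => [|u r] /=; first by rewrite e0i.
by rewrite cat_path last_rcons /= e0i => ->.
Qed.

(** Index of the furthest neighbour of the head, 0 if there is none. The furthest chords from the
    two ends cross when the reaches of [s] and [rev s] add up to at least [size s]. *)
Definition reach z s := \max_(i < size s | e (nth z s 0) (nth z s i)) (i : nat).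

Lemma leq_reach z s i : i < size s -> e (nth z s 0) (nth z s i) -> i <= reach z s.
Proof. by move=> lt ei; apply: (leq_bigmax_cond (Ordinal lt)). Qed.

Lemma reach_lt z s : 0 < size s -> reach z s < size s.
Proof.
move=> s0; rewrite -(prednK s0) ltnS; apply/bigmax_leqP => i _.
by have := ltn_ord i; lia.
Qed.

Lemma reach_edge z s i : i < size s -> e (nth z s 0) (nth z s i) ->
  e (nth z s 0) (nth z s (reach z s)).
Proof.
move=> lt ei; pose A := [pred j : 'I_(size s) | e (nth z s 0) (nth z s j)].
have A0 : 0 < #|A| by apply/card_gt0P; exists (Ordinal lt).
have [j ej E] := eq_bigmax_cond (fun j : 'I_(size s) => j : nat) A0.
suff -> : reach z s = j by [].
by rewrite -E; apply: eq_bigl => k; rewrite inE.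
Qed.

Lemma dg_edge_index W z s : longest W s -> 0 < size s -> 0 < dg W (nth z s 0) ->
  exists2 i, i < size s & e (nth z s 0) (nth z s i).
Proof.
move=> ls s0 /card_gt0P [y]; rewrite inE => /andP[yW ey].
have ys := longest_closed ls s0 yW ey.
by exists (index y s); rewrite ?index_mem ?nth_index.
Qed.

Lemma longest_rotate W z s i : longest W s -> 0 < i < size s ->
  e (nth z s 0) (nth z s i) ->
  exists s', [/\ longest W s', perm_eq (take i s') (take i s), drop i s' = drop i s,
    nth z s' 0 = nth z s i.-1
    & forall k, k < size s - i -> nth z (rev s') k = nth z (rev s) k].
Proof.
move=> [gs mx] i0m e0i; have [i0 im] := andP i0m.
have szt : size (take i s) = i by rewrite size_take im.
have dr : drop i (rev (take i s) ++ drop i s) = drop i s.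
  by apply: drop_size_cat; rewrite size_rev.
exists (rev (take i s) ++ drop i s); split => //.
- split; first exact: rotate_path i0m e0i.
  by move=> r /mx; rewrite size_cat size_rev -size_cat cat_take_drop.
- by rewrite take_size_cat ?size_rev // perm_rev.
- by rewrite nth_cat size_rev szt i0 nth_rev szt // subn1 nth_take // ltn_predL.
move=> k lt; rewrite -[s in RHS](cat_take_drop i s) !rev_cat !nth_cat size_rev size_drop.
by rewrite lt.
Qed.

(** These are the predecessors along [s] of the neighbours of the head, that is, the heads obtained
    by one rotation. *)
Lemma rotation_ends W z s : longest W s -> 0 < size s ->
  exists2 A : {set T}, dg W (nth z s 0) <= #|A| &
    forall a, a \in A -> exists i : nat,
      [/\ 0 < i < size s, e (nth z s 0) (nth z s i) & a = nth z s i.-1].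
Proof.
move=> ls s0; have [[us _ _] _] := ls.
pose L := [seq nth z s i.-1 | i <- iota 1 (size s).-1 & e (nth z s 0) (nth z s i)].
have idx (i : nat) : i \in [seq i <- iota 1 (size s).-1 | e (nth z s 0) (nth z s i)] ->
    0 < i < size s /\ e (nth z s 0) (nth z s i).
  by rewrite mem_filter mem_iota => /and3P[? -> lt]; split => //; move: s0 lt; clear; lia.
have inj (i j : nat) : 0 < i < size s -> 0 < j < size s ->
    nth z s i.-1 = nth z s j.-1 -> i = j.
  case/andP=> i0 im /andP[j0 jm] /eqP.
  by rewrite nth_uniq ?(leq_ltn_trans (leq_pred _)) //; move: i0 j0; clear; lia.
have uL : uniq L.
  rewrite map_inj_in_uniq ?filter_uniq ?iota_uniq // => i j /idx [i0 _] /idx [j0 _].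
  exact: inj.
exists [set x in L]; last first.
  by move=> a; rewrite inE => /mapP [i /idx [? ?] ->]; exists i.
rewrite cardsE; move/card_uniqP: uL => ->.
apply: leq_trans (longest_dg z ls s0) _.
rewrite size_map size_filter (count_nth z).
have {1}-> : size s = 1 + (size s).-1 by move: s0; clear; lia.
by rewrite count_iotaD /= e_irr add0n.
Qed.

(* Every neighbour of [nth z s 0] with index [i] makes [nth z s i.-1] the end of
   the path rotated at [i], which reaches no further than [s] by extremality. *)
Lemma half_separation W z s t : longest W s -> 0 < size s ->
  (forall s', longest W s' -> reach z s' + reach z (rev s') <= reach z s + reach z (rev s)) ->
  reach z s + reach z (rev s) < size s ->
  (forall x, x \in W -> t <= dg W x) -> 0 < t ->
  exists2 A : {set T}, #|A| = t &
    (forall a, a \in A -> a \in take (reach z s) s /\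
       forall y, y \in W -> e a y -> y \in take (reach z s).+1 s).
Proof.
move=> ls s0 ext nocross degt t0.
have [[us sW _] _] := ls.
have headW : nth z s 0 \in W by apply: sW; rewrite mem_nth.
have lastW : nth z (rev s) 0 \in W.
  by apply: sW; rewrite -mem_rev mem_nth // size_rev.
have [A0 cA0 HA0] := rotation_ends z ls s0.
have [A AL cA] := subset_card (leq_trans (degt _ headW) cA0).
exists A => // a /(subsetP AL) /HA0 [i [i0m e0i ->]].
have [i0 im] := andP i0m.
have lei : i <= reach z s by apply: leq_reach.
have lt_ri : reach z (rev s) < size s - i.
  by move: nocross lei; clear; lia.
split.
  rewrite in_take_nth // ?(leq_ltn_trans (leq_pred _) im) //.
  by apply: leq_trans lei; rewrite ltn_predL.
have [s' [ls' pt dr h' nth']] := longest_rotate ls i0m e0i.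
have sz' : size s' = size s.
  by apply/eqP; rewrite eqn_leq (proj2 ls) ?(proj2 ls') //; [case: ls | case: ls'].
have [j jlt ej] : exists2 j, j < size (rev s) & e (nth z (rev s) 0) (nth z (rev s) j).
  apply: (dg_edge_index (W := W)); rewrite ?size_rev //; first exact: longest_rev.
  exact: leq_trans t0 (degt _ lastW).
(* The last vertex and its furthest neighbour lie in the part not moved by the rotation, so the
   reach from that end cannot drop. *)
have r_rev : reach z (rev s) <= reach z (rev s').
  apply: leq_reach; first by rewrite size_rev sz' (leq_trans lt_ri) ?leq_subr.
  by rewrite !nth' ?(leq_ltn_trans _ lt_ri) //; exact: reach_edge jlt ej.
have r_s' : reach z s' <= reach z s by move: (ext _ ls') r_rev; clear; lia.
rewrite -h' => y yW ey.
have ys' : y \in s' by apply: (longest_closed (z := z) ls') => //; rewrite sz'.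
have lty : index y s' < size s' by rewrite index_mem.
have := leq_reach (z := z) lty; rewrite nth_index // => /(_ ey) iy.
have : y \in take (reach z s).+1 s' by rewrite in_take // ltnS (leq_trans iy).
have gi : (reach z s).+1 = i + ((reach z s).+1 - i) by rewrite subnKC // leqW.
by rewrite gi !takeD dr !mem_cat (perm_mem pt).
Qed.

(** * Separated sets, long cycles and low degrees *)

(** The obstruction to a long cycle: [X] and [Y] omit at most one vertex of [W], and [t] vertices on
    each side have no neighbour on the other side. *)
Definition separated W t := exists A B X Y : {set T},
  [/\ [/\ A \subset X, B \subset Y, X \subset W, Y \subset W & [disjoint X & Y]],
      #|A| = t, #|B| = t, #|W| <= (#|X| + #|Y|).+1
    & (forall a y, a \in A -> y \in Y -> ~~ e a y) /\
      (forall b x, b \in B -> x \in X -> ~~ e b x)].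

Lemma separatedI W z s t : longest W s -> 0 < size s ->
  (forall s', longest W s' -> reach z s' + reach z (rev s') <= reach z s + reach z (rev s)) ->
  reach z s + reach z (rev s) < size s ->
  (forall x, x \in W -> t <= dg W x) -> 0 < t ->
  separated W t.
Proof.
move=> ls s0 ext nocross degt t0.
have [[us sW _] _] := ls.
have [A cA HA] := half_separation ls s0 ext nocross degt t0.
have s0' : 0 < size (rev s) by rewrite size_rev.
have ext' s' : longest W s' ->
    reach z s' + reach z (rev s') <= reach z (rev s) + reach z (rev (rev s)).
  by rewrite revK [X in _ <= X]addnC; exact: ext.
have nocross' : reach z (rev s) + reach z (rev (rev s)) < size (rev s).
  by rewrite revK size_rev addnC.
have [B cB HB] := half_separation (longest_rev ls) s0' ext' nocross' degt t0.
set g := reach z s in nocross HA *; set h := reach z (rev s) in nocross HB *.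
(* The vertex at index [g] is in neither set: it may be adjacent to both [A] and [B]. Vertices of
   [W] off the path go to [Y]. *)
exists A, B, [set x in take g s], (W :\: [set x in take g.+1 s]).
have revt k x : x \in take k (rev s) -> x \in drop (size s - k) s.
  by rewrite take_rev mem_rev.
split => //.
- split.
  + by apply/subsetP => a /HA[]; rewrite inE.
  + apply/subsetP => b /HB[/revt bd _]; rewrite !inE.
    rewrite (sW _ (mem_drop bd)) andbT; apply/negP => bt.
    by apply: (mem_take_drop us _ bt bd); lia.
  + by apply/subsetP => x; rewrite inE => /mem_take /sW.
  + exact: subsetDl.
  + rewrite -setI_eq0; apply/eqP/setP => x; rewrite !inE; apply/negbTE/negP.
    case/and3P => xt nx _; case/negP: nx.
    by move: xt; rewrite -{1}(@take_takel _ g g.+1 s) // => /mem_take.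
- have sub : [set x in take g.+1 s] \subset W.
    by apply/subsetP => x; rewrite inE => /mem_take /sW.
  rewrite cardsDS // !cardsE.
  move/card_uniqP: (take_uniq g us) => ->; move/card_uniqP: (take_uniq g.+1 us) => ->.
  have gm : g < size s by exact: reach_lt.
  by rewrite !size_takel ?(ltnW gm) //; lia.
split.
  move=> a y /HA[_ Ha]; rewrite !inE => /andP[ny yW]; apply: contra ny; exact: Ha.
move=> b x /HB[_ Hb]; rewrite inE => xt; apply/negP => ebx.
have xW := sW _ (mem_take xt).
have := revt _ _ (Hb _ xW ebx) => xd.
by apply: (mem_take_drop us _ xt xd); lia.
Qed.

Lemma dg_le_card W S x : (forall y, y \in W -> e x y -> y \in S) -> dg W x <= #|S|.
Proof.
move=> H; apply: subset_leq_card; apply/subsetP => y; rewrite inE => /andP[].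
exact: H.
Qed.

Lemma dg_avoid W (Y : {set T}) x : x \in W -> Y \subset W -> x \notin Y ->
  (forall y, y \in Y -> ~~ e x y) -> dg W x + #|Y| < #|W|.
Proof.
move=> xW sYW xY H.
have : dg W x <= #|(W :\: Y) :\ x|.
  apply: dg_le_card => y yW exy; rewrite !inE yW andbT.
  apply/andP; split; first by apply/eqP => E; move: exy; rewrite E e_irr.
  by apply: contraL exy; exact: H.
have := cardsD1 x (W :\: Y); rewrite inE xY xW /= (cardsDS sYW).
by have := subset_leq_card sYW; lia.
Qed.

(** The volume is split at [C], the complement of [A] and [B] in [W]: [C] is at most complete, and a
    vertex of [A] has at most [|W| - 1 - |Y|] neighbours in [W] and [|W| - t - |Y|] in [C]; likewise
    for [B] with [X]. *)
Lemma separated_vol W t : 0 < t -> separated W t ->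
  (forall x, x \in W -> t <= dg W x) ->
  t.*2 < #|W| /\ vol W + t.*2 * (#|W| - 1 - t) <= #|W| * (#|W|).-1.
Proof.
move=> t0 [A [B [X [Y [[sAX sBY sXW sYW dXY] cA cB cW [nA nB]]]]]] degt.
have sAW := subset_trans sAX sXW; have sBW := subset_trans sBY sYW.
have AY x : x \in A -> x \notin Y.
  by move/(subsetP sAX) => xX; move/disjointFr: dXY => ->.
have BX x : x \in B -> x \notin X.
  by move/(subsetP sBY) => xX; move/disjointFl: dXY => ->.
have dA a : a \in A -> dg W a + #|Y| < #|W|.
  by move=> aA; apply: dg_avoid; rewrite ?(subsetP sAW) ?AY // => y; exact: nA.
have dB b : b \in B -> dg W b + #|X| < #|W|.
  by move=> bB; apply: dg_avoid; rewrite ?(subsetP sBW) ?BX // => y; exact: nB.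
have [a aA] : exists a, a \in A by apply/card_gt0P; rewrite cA.
have [b bB] : exists b, b \in B by apply/card_gt0P; rewrite cB.
have lt2 : t.*2 < #|W|.
  move: (dA _ aA) (dB _ bB) (degt _ (subsetP sAW _ aA)) (degt _ (subsetP sBW _ bB)).
  by move: cW; clear; lia.
split => //.
have dAB : [disjoint A & B].
  by apply: disjointWl sAX _; apply: disjointWr sBY _.
set C := W :\: (A :|: B).
have sABW : A :|: B \subset W by rewrite subUset sAW.
have cAB : #|A :|: B| = t.*2.
  by rewrite cardsU (disjoint_setI0 dAB) cards0 subn0 cA cB addnn.
have cC : #|C| = #|W| - t.*2 by rewrite cardsDS // cAB.
have sCW : C \subset W by exact: subsetDl.
have cYX : #|X| + #|Y| <= #|W|.
  rewrite -cardsUI (disjoint_setI0 dXY) cards0 addn0.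
  by apply: subset_leq_card; rewrite subUset sXW.
have dCA x : x \in A -> dg C x + t + #|Y| <= #|W|.
  move=> xA.
  have : dg C x <= #|(W :\: A) :\: Y|.
    apply: dg_le_card => y; rewrite !inE negb_or => /andP[/andP[yA yB] yW] exy.
    by rewrite yA yW !andbT; apply: contraL exy; exact: nA.
  have sYWA : Y \subset W :\: A.
    apply/subsetP => y yY; rewrite inE (subsetP sYW) // andbT.
    by apply: contraL yY; exact: AY.
  move: (subset_leq_card sYWA) (subset_leq_card sAW).
  by rewrite (cardsDS sYWA) (cardsDS sAW) cA; clear; lia.
have dCB x : x \in B -> dg C x + t + #|X| <= #|W|.
  move=> xB.
  have : dg C x <= #|(W :\: B) :\: X|.
    apply: dg_le_card => y; rewrite !inE negb_or => /andP[/andP[yA yB] yW] exy.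
    by rewrite yB yW !andbT; apply: contraL exy; exact: nB.
  have sXWB : X \subset W :\: B.
    apply/subsetP => y yX; rewrite inE (subsetP sXW) // andbT.
    by apply: contraL yX; exact: BX.
  move: (subset_leq_card sXWB) (subset_leq_card sBW).
  by rewrite (cardsDS sXWB) (cardsDS sBW) cB; clear; lia.
have WC : W :\: C = A :|: B by rewrite setDDr setDv set0U; apply/setIidPr.
have sA : \sum_(x in A) (dg C x + dg W x) <= t * (#|W|.*2 - 1 - t - #|Y|.*2).
  rewrite -cA -sum_nat_const; apply: leq_sum => x xA; rewrite cA.
  by move: (dCA _ xA) (dA _ xA); clear; lia.
have sB : \sum_(x in B) (dg C x + dg W x) <= t * (#|W|.*2 - 1 - t - #|X|.*2).
  rewrite -cB -sum_nat_const; apply: leq_sum => x xB; rewrite cB.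
  by move: (dCB _ xB) (dB _ xB); clear; lia.
have eAB : \sum_(x in A :|: B) (dg C x + dg W x) =
    \sum_(x in A) (dg C x + dg W x) + \sum_(x in B) (dg C x + dg W x).
  by rewrite -bigU //; apply: eq_bigl => x; rewrite !inE.
rewrite (vol_split sCW) WC eAB.
have := vol_le_complete C; rewrite cC => vC.
apply: leq_trans (separated_arith (t := t) (a := #|X|) (b := #|Y|) _ _ cYX cW lt2).
- by rewrite leq_add2r leq_add // leq_add.
- by rewrite -cA subset_leq_card.
- by rewrite -cB subset_leq_card.
Qed.

(** The density hypothesis excludes separation. Take a longest path of maximal reach sum. If it has
    fewer than [2t] vertices, it closes to a cycle, which is all of [W] or is separated from the
    rest. Otherwise its furthest chords cross and give the cycle, or fail to cross and give a
    separation. *)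
Lemma long_cycle W t : 0 < t -> (forall x, x \in W -> t <= dg W x) -> 0 < #|W| ->
  #|W| <= t.*2 \/ #|W| * (#|W|).-1 < vol W + t.*2 * (#|W| - 1 - t) ->
  exists2 c, gcycle W c & minn #|W| t.*2 <= size c.
Proof.
move=> t0 degt W0 dense.
have nosep : ~ separated W t.
  move/(separated_vol t0)/(_ degt) => [h1 h2].
  by case: dense; [rewrite leqNgt h1 | rewrite ltnNge h2].
have [z zW] : exists z, z \in W by apply/card_gt0P.
have [s0 ls0] := exists_longest W.
have [||s ls ext] := @exists_maximal _ (longest W) (fun s => reach z s + reach z (rev s)) (size s0 + size s0).
- by exists s0.
- move=> s ls; have sp := longest_nonempty W0 ls.
  have := @reach_lt z s sp; have := @reach_lt z (rev s); rewrite size_rev => /(_ sp).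
  by have := (proj2 ls0) _ (proj1 ls); lia.
have sp := longest_nonempty W0 ls.
have [gs mx] := ls; have [us sW ps] := gs.
have h0W : nth z s 0 \in W by apply: sW; rewrite mem_nth.
have lW : nth z s (size s).-1 \in W by apply: sW; rewrite mem_nth // ltn_predL.
have a_t := leq_trans (degt _ h0W) (longest_dg z ls sp).
have b_t := leq_trans (degt _ lW) (longest_dg_last z ls sp).
have [lt_m|le_m] := ltnP (size s) t.*2.
  have [|c gc pcs] := crossing_spanning_cycle (z := z) gs sp; first by lia.
  exists c => //; rewrite (perm_size pcs) geq_min leqNgt -[X in X || _]negbK.
  case: (ltnP (size s) #|W|) => //= lt_mW; case: nosep.
  have clo := longest_cycle_closed ls gc pcs.
  have cs : #|[set x in s]| = size s by rewrite cardsE; apply/card_uniqP.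
  have sub : [set x in s] \subset W by apply/subsetP => x; rewrite inE; exact: sW.
  have cY : #|W :\: [set x in s]| = #|W| - size s by rewrite cardsDS ?cs.
  have [y] : exists y, y \in W :\: [set x in s] by apply/card_gt0P; rewrite cY; lia.
  rewrite !inE => /andP[ys yW].
  have tX : t <= #|[set x in s]|.
    apply: leq_trans a_t _; rewrite cs; exact: count_size.
  have tY : t <= #|W :\: [set x in s]|.
    apply: leq_trans (degt _ yW) _; apply: subset_leq_card; apply/subsetP => u.
    rewrite !inE => /andP[uW eyu]; rewrite uW andbT; apply: contra ys => us'.
    by apply: (clo u) => //; rewrite e_sym.
  have [A sA cA] := subset_card tX; have [B sB cB] := subset_card tY.
  exists A, B, [set x in s], (W :\: [set x in s]); split => //.
  - split => //; first exact: subsetDl.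
    by rewrite -setI_eq0 setIDA setIC -setIDA setDv setI0.
  - by rewrite cs cY subnKC ?leqnSn // ltnW.
  split.
    move=> a u /(subsetP sA); rewrite inE => sa; rewrite !inE => /andP[us' uW].
    by apply: contra us' => eau; apply: (clo a).
  move=> b x /(subsetP sB); rewrite !inE => /andP[bs bW] xs.
  by apply: contra bs => ebx; apply: (clo x) => //; rewrite e_sym.
have [nocr|cr] := ltnP (reach z s + reach z (rev s)) (size s).
  by case: nosep; exact: separatedI nocr degt t0.
have [j jlt ej] : exists2 j, j < size s & e (nth z s 0) (nth z s j).
  by apply: (dg_edge_index ls) => //; have := degt _ h0W; lia.
have [i ilt ei] : exists2 i, i < size (rev s) & e (nth z (rev s) 0) (nth z (rev s) i).
  apply: (dg_edge_index (longest_rev ls)); rewrite ?size_rev //.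
  by rewrite nth_rev // subn1; have := degt _ lW; lia.
have [|c gc lc] := crossing_long_cycle (z := z) gs.
  have r1 := reach_lt z sp.
  have r2 : reach z (rev s) < size s by rewrite -size_rev; apply: reach_lt; rewrite size_rev.
  exists ((size s).-1 - reach z (rev s)), (reach z s); split => //; first by lia.
    exact: reach_edge jlt ej.
  have := reach_edge ilt ei; rewrite !nth_rev // subn1 e_sym.
  by have -> : size s - (reach z (rev s)).+1 = (size s).-1 - reach z (rev s) by lia.
by exists c => //; lia.
Qed.

(* A longest path of maximal end-degree sum [a + b] with [a <= b] cannot be closed,
   so [a + b < #|W|]; by maximality the [a] ends of its rotations have degree at most [a]. *)
Lemma nonhamiltonian_low_degrees W : 2 < #|W| ->
  (forall c, gcycle W c -> size c <> #|W|) ->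
  exists h, exists S : {set T}, [/\ h.*2 < #|W|, 0 < h, S \subset W, #|S| = h
     & forall x, x \in S -> dg W x <= h].
Proof.
move=> W2 noham; have W0 : 0 < #|W| by exact: ltn_trans W2.
have [z zW] : exists z, z \in W by apply/card_gt0P.
pose F s := dg W (nth z s 0) + dg W (nth z (rev s) 0).
have [s0 ls0] := exists_longest W.
have [||s1 ls1 ext1] := @exists_maximal _ (longest W) F (#|W| + #|W|).
- by exists s0.
- by move=> s _; rewrite leq_add ?dg_le.
have [s [ls ext le_ab]] : exists s, [/\ longest W s, forall s', longest W s' -> F s' <= F s
    & dg W (nth z s 0) <= dg W (nth z (rev s) 0)].
  case: (leqP (dg W (nth z s1 0)) (dg W (nth z (rev s1) 0))) => [le|/ltnW le].
    by exists s1.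
  exists (rev s1); split; rewrite ?revK //; first exact: longest_rev.
  by move=> s' /ext1; rewrite /F revK [X in _ <= X]addnC.
have sp := longest_nonempty W0 ls; have [gs mx] := ls; have [us sW _] := gs.
have Es : nth z (rev s) 0 = nth z s (size s).-1 by rewrite nth_rev // subn1.
have lea := longest_dg z ls sp; have leb := longest_dg_last z ls sp.
have cs : #|[set x in s]| = size s by rewrite cardsE; apply/card_uniqP.
have sub : [set x in s] \subset W by apply/subsetP => x; rewrite inE; exact: sW.
have sm := gpath_size gs.
(* If the path closes up, its vertices have no neighbours outside it. It misses some of [W] but has
   more than half of it, so the missed vertices form [S]. *)
have [big|small] := leqP #|W| (dg W (nth z s 0) + dg W (nth z (rev s) 0)).
  have [|c gc pcs] := crossing_spanning_cycle (z := z) gs sp.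
    by move: sm lea leb big; rewrite Es; clear; lia.
  have neq : size s <> #|W| by rewrite -(perm_size pcs); exact: noham.
  have clo := longest_cycle_closed ls gc pcs.
  have dS x : x \in s -> dg W x < size s.
    move=> xs; have: dg W x <= #|[set y in s] :\ x|.
      apply: dg_le_card => y yW exy; rewrite !inE (clo x y) // andbT.
      by apply/eqP => E; move: exy; rewrite E e_irr.
    by have := cardsD1 x [set y in s]; rewrite inE xs cs => ->.
  have cY : #|W :\: [set x in s]| = #|W| - size s by rewrite cardsDS ?cs.
  have half : #|W| < (size s).*2.
    have ha : dg W (nth z s 0) < size s by rewrite dS // mem_nth.
    have hb : dg W (nth z (rev s) 0) < size s by rewrite Es dS // mem_nth // ltn_predL.
    by move: ha hb big; clear; lia.
  exists (#|W| - size s), (W :\: [set x in s]); split => //.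
  - by move: half sm; clear; lia.
  - by rewrite subn_gt0 ltn_neqAle sm andbT; apply/eqP.
  - exact: subsetDl.
  move=> x; rewrite !inE => /andP[xs xW]; rewrite -cY.
  apply: dg_le_card => y yW exy; rewrite !inE yW andbT; apply: contra xs => ys.
  by apply: (clo y) => //; rewrite e_sym.
have headW : nth z s 0 \in W by apply: sW; rewrite mem_nth.
(* For an isolated head [h = 0] is not allowed; the head alone serves with [h = 1]. *)
have [a0|a0] := posnP (dg W (nth z s 0)).
  exists 1, [set nth z s 0]; split; rewrite ?cards1 ?sub1set //.
  by move=> x; rewrite inE => /eqP ->; rewrite a0.
have [A0 cA0 HA0] := rotation_ends z ls sp.
have [A AL cA] := subset_card cA0.
exists (dg W (nth z s 0)), A; split => //.
- by move: small le_ab; clear; lia.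
- apply/subsetP => a /(subsetP AL) /HA0 [i [/andP[_ im] _ ->]]; apply: sW.
  by rewrite mem_nth // (leq_ltn_trans (leq_pred i)).
move=> a /(subsetP AL) /HA0 [i [i0m e0i ->]].
have [s' [ls' _ _ h' nth']] := longest_rotate ls i0m e0i.
have := ext _ ls'; rewrite /F h' nth' ?leq_add2r // subn_gt0.
by case/andP: i0m.
Qed.


(** * Bondy's argument for cycles of a prescribed length *)

Lemma gcycle_rot W s i : gcycle W s -> gcycle W (rot i s).
Proof. by case=> us sW cs; split; rewrite ?rot_uniq ?rot_cycle // => x; rewrite mem_rot; exact: sW. Qed.

Lemma gcycle_path W s : gcycle W s -> gpath W s.
Proof.
case=> us sW; case: s us sW => // x s us sW /=; rewrite rcons_path => /andP[ps _].
by split.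
Qed.

Lemma gcycle_close W z s : gcycle W s -> 0 < size s ->
  e (nth z s (size s).-1) (nth z s 0).
Proof.
case=> _ _; case: s => //= x s; rewrite rcons_path => /andP[_ exl] _.
by rewrite -(last_nth z).
Qed.

Lemma nth_rot (z : T) s i j : i <= size s -> j < size s ->
  nth z (rot i s) j = nth z s ((i + j) %% size s).
Proof.
move=> le_i lt_j; rewrite /rot nth_cat size_drop nth_drop.
case: ltnP => h; first by rewrite modn_small //; move: h; clear; lia.
have -> : i + j = j - (size s - i) + size s by move: h le_i; clear; lia.
rewrite modnDr modn_small; last by move: lt_j; clear; lia.
by rewrite nth_take //; move: h lt_j le_i; clear; lia.
Qed.

(** Over all rotations each vertex is head once and last once, so a bound on the two ends of the
    closing edge bounds twice the sum. *)
Lemma sum_rot (F : T -> nat) z s c :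
  (forall i, i < size s -> F (nth z (rot i s) 0) + F (nth z (rot i s) (size s).-1) <= c) ->
  (\sum_(x <- s) F x).*2 <= size s * c.
Proof.
move=> H; have [s0|s0] := posnP (size s); first by rewrite (size0nil s0) big_nil.
rewrite (big_nth z) big_mkord -addnn.
rewrite {2}(reindex_inj (@ord_pred_inj _)) -big_split /=.
have -> : size s * c = \sum_(i < size s) c by rewrite sum_nat_const card_ord.
apply: leq_sum => i _.
apply: leq_trans (H _ (ltn_ord i)).
have lt1 : (size s).-1 < size s by rewrite ltn_predL.
rewrite !nth_rot // ?(ltnW (ltn_ord i)) // addn0 (modn_small (ltn_ord i)) //.
by rewrite -subn1 -addnBA // subn1.
Qed.

Lemma index_cycle W z s (t : seq nat) : gpath W s -> uniq t -> all (ltn^~ (size s)) t ->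
  cycle (fun i j => e (nth z s i) (nth z s j)) t -> gcycle W (map (nth z s) t).
Proof.
move=> [us sW _] ut /allP at_ ct; split.
- rewrite map_inj_in_uniq // => i j /at_ lti /at_ ltj /eqP.
  by rewrite nth_uniq // => /eqP.
- by move=> x /mapP [i /at_ lti ->]; apply: sW; rewrite mem_nth.
case: t ut at_ ct => //= i t _ _ ct.
by rewrite -map_rcons path_map.
Qed.

Lemma last_iota a c : last a (iota a.+1 c) = a + c.
Proof. by elim: c a => [|c IH] a /=; rewrite ?addn0 // IH addSnnS. Qed.

Lemma path_iota W z s a c : gpath W s -> a + c < size s ->
  path (fun i j => e (nth z s i) (nth z s j)) a (iota a.+1 c).
Proof.
case=> _ _ ps; elim: c a => //= c IHc a lt.
rewrite IHc; last by rewrite addSnnS.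
rewrite andbT; apply: (elimT (sortedP z) ps); apply: leq_ltn_trans lt.
by rewrite addnS ltnS leq_addr.
Qed.

(* Bondy: for the edge [last s - head s] of a spanning cycle, the neighbour indices
   [a] of the head are matched with non-neighbour indices of the last vertex, so that
   the missing cycle has length [l]. *)
Lemma bondy_ends W z s l : gcycle W s -> 3 < l < size s ->
  (forall c, gcycle W c -> size c <> l) ->
  count (e (nth z s 0)) s + count (e (nth z s (size s).-1)) s <= size s /\
  forall u, u < l - 3 -> ~~ e (nth z s 0) (nth z s ((size s).+2 - l + u)) ->
    ~~ e (nth z s (size s).-1) (nth z s u.+1) ->
    count (e (nth z s 0)) s + count (e (nth z s (size s).-1)) s < size s.
Proof.
move=> gs lL nol.
have gp := gcycle_path gs.
rewrite !(count_nth z).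
have s0 : 0 < size s by move: lL; clear; lia.
have clo := gcycle_close z gs s0.
have := @crossing_cycle W z s _ _ gp.
have := fun t => @index_cycle W z s t gp.
have := fun a c => @path_iota W z s a c gp.
move: (size s) lL s0 clo => L lL L0 clo pth idx cross.
set a := fun i => e (nth z s 0) (nth z s i).
set b := fun i => e (nth z s L.-1) (nth z s i).
have lin (p : pred nat) : count p (iota 0 L) = p 0 + count p (iota 1 (L - 2)) + p L.-1.
  have E : L = 1 + ((L - 2) + 1) by move: lL; clear; lia.
  rewrite {1}E !count_iotaD /= !addn0 !add0n addnA; congr (_ + _ + nat_of_bool (p _)).
  by move: lL; clear; lia.
rewrite !lin.
have -> : a 0 = false by exact: e_irr.
have -> : b L.-1 = false by exact: e_irr.
have -> : a L.-1 = true by rewrite /a e_sym.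
have -> : b 0 = true by [].
(* The interior indices are cut after [L + 1 - l] places for [a] and after [l - 3] for [b]; the
   first block of each is matched with the second block of the other. *)
rewrite [count a _](_ : _ = count a (iota 1 (L.+1 - l)) + count a (iota (L.+2 - l) (l - 3))); last first.
  have E : L - 2 = (L.+1 - l) + (l - 3) by move: lL; clear; lia.
  by rewrite E count_iotaD; congr (_ + count _ (iota _ _)); move: lL; clear; lia.
rewrite [count b _](_ : _ = count b (iota 1 (l - 3)) + count b (iota (l - 2) (L.+1 - l))); last first.
  have E : L - 2 = (l - 3) + (L.+1 - l) by move: lL; clear; lia.
  by rewrite E count_iotaD; congr (_ + count _ (iota _ _)); move: lL; clear; lia.
have h1 : count a (iota 1 (L.+1 - l)) + count b (iota (l - 2) (L.+1 - l)) <= L.+1 - l.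
  apply: count_iota_disjoint => u lt; apply/negP => /andP[au bu].
  (* The cycle [0, u + 1, ..., u + l - 2, L - 1], closed by the edge from last to head, has length
     [l]. *)
  case: (nol (map (nth z s) (0 :: rcons (iota (1 + u) (l - 2)) L.-1))); last first.
    by rewrite size_map /= size_rcons size_iota; move: lL; clear; lia.
  apply: idx.
  - rewrite cons_uniq mem_rcons inE mem_iota rcons_uniq mem_iota iota_uniq andbT.
    by move: lL lt; clear; lia.
  - suff H (i : nat) : i \in 0 :: rcons (iota (1 + u) (l - 2)) L.-1 -> i < L by apply/allP.
    by rewrite inE mem_rcons inE mem_iota; move: lL lt; clear; lia.
  have -> : l - 2 = (l - 3).+1 by move: lL; clear; lia.
  rewrite /= !rcons_path !last_rcons last_iota clo andbT [e _ _]au /=.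
  rewrite pth; last by move: lL lt; clear; lia.
  rewrite e_sym; move: bu; rewrite /b.
  by have -> : 1 + u + (l - 3) = l - 2 + u by move: lL; clear; lia.
(* Here the chords cross, and the crossing cycle has length [(u + 2) + (l - 2 - u) = l]. *)
have dis u : u < l - 3 -> ~~ (a (L.+2 - l + u) && b (1 + u)).
  move=> lt; apply/negP => /andP[au bu].
  have := cross (1 + u) (L.+2 - l + u); rewrite -/(a _) au e_sym -/(b _) bu.
  case=> //; try by move: lL lt; clear; lia.
  move=> c gc [sc _]; apply: (nol c gc); rewrite sc.
  by move: lL lt; clear; lia.
have := count_iota_disjoint dis; rewrite -/(L.+2 - l) => h2; split.
  by move: h1 h2 lL; rewrite /=; clear; lia.
move=> u lt au bu.
have := count_iota_disjoint_lt lt au bu dis.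
by move: h1 lL; rewrite /=; clear; lia.
Qed.


Lemma dg_cycle s x : uniq s -> dg [set y in s] x = count (e x) s.
Proof. by move=> us; apply: dg_count => // y; rewrite inE. Qed.

Lemma bondy_vol W s l : gcycle W s -> 3 < l < size s ->
  (forall c, gcycle W c -> size c <> l) ->
  (vol [set x in s]).*2 <= size s * size s.
Proof.
move=> gs lL nol; have [us _ _] := gs.
have [z _] : exists z, z \in s.
  by case: s lL {gs us} => [|z s _]; [rewrite ltn0 andbF | exists z; rewrite mem_head].
have -> : vol [set x in s] = \sum_(x <- s) count (e x) s.
  rewrite /vol big_uniq //=; apply: eq_big => x; first by rewrite inE.
  by rewrite dg_cycle.
apply: (@sum_rot (fun x => count (e x) s) z) => i lt.
have grs := gcycle_rot i gs.
have := @bondy_ends W z (rot i s) l grs; rewrite size_rot => /(_ lL nol) [].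
have E x : count (e x) (rot i s) = count (e x) s.
  by apply/permP; rewrite perm_rot.
by rewrite !E.
Qed.

(** Two consecutive vertices of a longest cycle cannot both be adjacent to [x], as [x] could be
    inserted between them. *)
Lemma outside_degree W s x : gcycle W s -> x \in W -> x \notin s ->
  (forall c, gcycle W c -> size c <= size s) -> (dg [set y in s] x).*2 <= size s.
Proof.
move=> gs xW xs mx; have [us _ _] := gs.
rewrite dg_cycle // -[X in _ <= X]muln1.
have -> : count (e x) s = \sum_(y <- s) e x y.
  by rewrite -sum1_count big_mkcond; apply: eq_bigr => y _; case: (e x y).
apply: (@sum_rot (fun y => nat_of_bool (e x y)) x) => i lt.
have [] := gcycle_rot i gs; move: lt; rewrite -(size_rot i s).
have sub : rot i s =i s by move=> y; rewrite mem_rot.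
move: (rot i s) sub => r sub; case: r sub => // y r sub _ ur rW cr.
case ey : (e x (nth x (y :: r) 0)); case el : (e x (nth x (y :: r) (size (y :: r)).-1)) => //.
have sr : size (y :: r) = size s by apply/eqP; rewrite eq_sym -(uniq_size_uniq ur sub).
have : gcycle W (x :: y :: r); last by move/mx; rewrite -sr /= ltnn.
split.
- by rewrite cons_uniq sub xs.
- by move=> u; rewrite inE => /orP[/eqP -> //|/rW].
move: cr ey el; rewrite /= !rcons_path => /andP[-> _] -> /=.
by rewrite -(last_nth x) e_sym.
Qed.

(** For a longest cycle, of length [L], [bondy_vol] bounds the volume inside. An outer vertex
    contributes to the volume twice its degree to the cycle, at most [L], plus its degree among the
    [|W| - L] outer vertices. *)
Lemma exact_length W l L0 : 3 < l <= L0 ->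
  (exists2 c, gcycle W c & L0 <= size c) ->
  (exists2 c, gcycle W c & size c = l) \/
  (exists L, [/\ l < L, L0 <= L, L <= #|W| &
     (vol W).*2 <= L * L + (#|W| - L) * (L.*2 + (#|W| - L).-1.*2)]).
Proof.
move=> lL [c0 gc0 lc0].
case: (classic (exists2 c, gcycle W c & size c = l)) => [|no]; [by left | right].
have nol c : gcycle W c -> size c <> l by move=> gc sc; apply: no; exists c.
have [||c gc mx] := @exists_maximal _ (gcycle W) size #|W|.
- by exists c0.
- by move=> c /gcycle_path /gpath_size.
have L0c : L0 <= size c := leq_trans lc0 (mx _ gc0).
have lc : l < size c.
  by rewrite ltn_neqAle (leq_trans _ L0c) ?andbT; [apply/eqP => E; apply: (nol c) | case/andP: lL].
exists (size c); split => //; first by exact: gpath_size (gcycle_path gc).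
have [uc cW _] := gc.
have l3 : 3 < l < size c by rewrite lc andbT; case/andP: lL.
have v1 := bondy_vol gc l3 nol.
have cs : #|[set x in c]| = size c by rewrite cardsE; apply/card_uniqP.
have sub : [set x in c] \subset W by apply/subsetP => x; rewrite inE; exact: cW.
rewrite (vol_split sub) doubleD leq_add // -{1}cs -cardsDS //.
rewrite -sum_nat_const -muln2 big_distrl /=; apply: leq_sum => x; rewrite !inE => /andP[xc xW].
have : (dg [set y in c] x).*2 <= size c := outside_degree gc xW xc mx.
have : dg (W :\: [set y in c]) x < #|W| - size c.
  by rewrite -[in ltnRHS]cs -cardsDS // dg_lt // !inE xc.
rewrite (dgU x sub); move: (dg _ x) (dg _ x) (size c) => d1 d2 L; clear; lia.
Qed.

Lemma path_map_step (R : rel nat) b m a n : (forall i, a <= i -> i + m <= b -> R i (i + m)) ->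
  a + m * n <= b -> path R a [seq a + m * i | i <- iota 1 n].
Proof.
move=> H; elim: n => // n IHn le.
rewrite -[n.+1]addn1 iotaD map_cat cat_path IHn /=; last first.
  by apply: leq_trans le; rewrite leq_add2l leq_mul2l leqnSn orbT.
have -> : last a [seq a + m * i | i <- iota 1 n] = a + m * n.
  by case: (n) => [|p]; rewrite ?muln0 ?addn0 // -[p.+1]addn1 iotaD map_cat last_cat /= add1n addn1.
rewrite andbT add1n mulnS [m + _]addnC addnA; apply: H; first exact: leq_addr.
by rewrite -addnA [_ + m]addnC -mulnS.
Qed.

(* If there is no cycle of length [2k+2], then equality holds throughout Bondy's count,
   which forces all the chords between vertices at distance 3 on a spanning cycle;
   [k - 1] of them shorten that cycle to length [2k+2]. *)
Lemma half_degree_cycle W s k : 1 < k -> #|W| = 4 * k -> gcycle W s -> size s = 4 * k ->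
  (forall x, x \in W -> k.*2 <= dg W x) ->
  exists2 c, gcycle W c & size c = k.*2.+2.
Proof.
move=> k1 Wk gs sk degk; apply: NNPP => no.
have nol c : gcycle W c -> size c <> k.*2.+2 by move=> gc sc; apply: no; exists c.
have lL : 3 < k.*2.+2 < size s by rewrite sk; move: k1; clear; lia.
have [z _] : exists z, z \in W by apply/card_gt0P; rewrite Wk; move: k1; clear; lia.
have Ws : W =i s.
  have [us sW _] := gs.
  have sub : {subset s <= enum W} by move=> x /sW; rewrite mem_enum.
  have le : size (enum W) <= size s by rewrite -cardE Wk sk.
  by have [_ H] := uniq_min_size us sub le => x; rewrite H mem_enum.
(* In the rotation by [j + 1], vertex [j] comes last and vertex [j + 3] has index 2. *)
have chord j : j + 3 < size s -> e (nth z s j) (nth z s (j + 3)).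
  move=> lt; set r := rot j.+1 s.
  have gr : gcycle W r := gcycle_rot j.+1 gs.
  have sr : size r = size s by exact: size_rot.
  have [ur _ _] := gr.
  have Wr : W =i r by move=> x; rewrite mem_rot Ws.
  have lLr : 3 < k.*2.+2 < size r by rewrite sr.
  have [_ Hlt] := @bondy_ends W z r _ gr lLr nol.
  have lt0 : 0 < size r by rewrite sr (leq_ltn_trans _ lt).
  have d1 : k.*2 <= count (e (nth z r 0)) r.
    by rewrite -(dg_count _ ur Wr) degk // Wr mem_nth.
  have d2 : k.*2 <= count (e (nth z r (size r).-1)) r.
    by rewrite -(dg_count _ ur Wr) degk // Wr mem_nth // ltn_predL.
  (* This index is [2k + 1], and the chord would close the cycle [0, ..., 2k + 1]. If the partner
     chord, from the last vertex to index 2, were missing too, the degree sum would be below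
     [4k]. *)
  have far : ~~ e (nth z r 0) (nth z r ((size r).+2 - k.*2.+2 + 1)).
    rewrite sr sk; apply/negP => e0.
    case: (nol (map (nth z r) (iota 0 k.*2.+2))); last by rewrite size_map size_iota.
    apply: index_cycle (gcycle_path gr) _ _ _; first exact: iota_uniq.
      suff H (i : nat) : i \in iota 0 k.*2.+2 -> i < size r by apply/allP.
      by rewrite mem_iota sr sk; move: k1; clear; lia.
    rewrite -[cycle _ _]/(path _ 0 (rcons (iota 1 k.*2.+1) 0)) rcons_path (@last_iota 0 k.*2.+1) (path_iota z (gcycle_path gr)); last first.
      by rewrite sr sk; move: k1; clear; lia.
    rewrite e_sym; move: e0; congr (e _ (nth z r _) : Prop).
    by move: k1; clear; lia.
  have k3 : 1 < k.*2.+2 - 3 by move: k1; clear; lia.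
  have : e (nth z r (size r).-1) (nth z r 2).
    apply: contraT => n2; have := Hlt 1 k3 far n2; rewrite sr sk in d1 d2 *.
    by move: d1 d2; clear; lia.
  have lts : j.+1 <= size s by apply: leq_trans lt; rewrite ltnS leq_addr.
  have s3 : 2 < size s := ltnW (leq_ltn_trans (leq_addl j 3) lt).
  rewrite /r size_rot !nth_rot // ?ltn_predL ?(leq_ltn_trans _ s3) //.
  have -> : j.+1 + (size s).-1 = j + size s by rewrite addSnnS prednK // (leq_ltn_trans _ s3).
  have lj : j < size s by apply: leq_ltn_trans lt; rewrite leq_addr.
  by rewrite modnDr addSnnS !modn_small.
(* From [0] to [3(k - 1)] by [k - 1] chords, then along the cycle through [k + 2] more vertices up
   to index [4k - 1]. *)
pose t := 0 :: [seq 0 + 3 * i | i <- iota 1 k.-1] ++ iota (0 + 3 * k.-1).+1 k.+2.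
have st : size t = k.*2.+2.
  by rewrite -[size t]/(size (_ ++ _)).+1 size_cat size_map !size_iota; move: k1; clear; lia.
apply: (nol (map (nth z s) t)); last by rewrite size_map.
have inj3 : injective (fun i : nat => 0 + 3 * i) by move=> i j; clear; lia.
have mem3 (i : nat) : i \in [seq 0 + 3 * i | i <- iota 1 k.-1] -> 0 < i <= 3 * k.-1.
  case/mapP => j; rewrite mem_iota => jk ->; rewrite add0n leq_mul2l muln_gt0 /=.
  by move: jk k1; rewrite add1n; case: (k) => // p; rewrite /= ltnS.
have mem1 (i : nat) : i \in iota (0 + 3 * k.-1).+1 k.+2 -> 3 * k.-1 < i < 4 * k.
  by rewrite mem_iota; move: k1; clear; lia.
apply: index_cycle (gcycle_path gs) _ _ _.
- rewrite cons_uniq cat_uniq iota_uniq map_inj_uniq ?iota_uniq // andbT mem_cat negb_or.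
  apply/andP; split; first by apply/andP; split; apply/negP; [move/mem3 | move/mem1].
  by rewrite -all_predC; apply/allP => i /mem1 /andP[lt _]; apply/negP => /mem3 /andP[_]; rewrite leqNgt lt.
- suff H (i : nat) : i \in t -> i < size s by apply/allP.
  rewrite sk inE mem_cat => /orP[/eqP -> |/orP[/mem3|/mem1]]; move: k1; clear; lia.
rewrite /t -[cycle _ _]/(path _ 0 (rcons _ 0)) rcons_path cat_path last_cat.
have l3 : last 0 [seq 0 + 3 * i | i <- iota 1 k.-1] = 0 + 3 * k.-1.
  have -> : k.-1 = k.-2 + 1 by move: k1; clear; lia.
  by rewrite iotaD map_cat last_cat /= add1n addn1.
rewrite l3 last_iota (path_iota z (gcycle_path gs)); last by rewrite sk; move: k1; clear; lia.
rewrite (@path_map_step _ (size s).-1) /=; first last.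
- by rewrite sk; move: k1; clear; lia.
- move=> i _ le; apply: chord; apply: leq_ltn_trans le _.
  by rewrite ltn_predL sk; move: k1; clear; lia.
have := gcycle_close z gs; rewrite sk => /(_ _)/wrap[]; first by move: k1; clear; lia.
by have -> : 0 + 3 * k.-1 + k.+2 = (4 * k).-1 by move: k1; clear; lia.
Qed.

(** * Length [2k + 2] from minimum degree and edge count *)

(** The cycle of [long_cycle] is spanning, so [exact_length] leaves only [L = |W|], where twice the
    volume is at most [|W|^2]; but it is at least [2t|W|]. *)
Lemma dirac_exact W t l : #|W| < t.*2 -> (forall x, x \in W -> t <= dg W x) ->
  3 < l <= #|W| -> exists2 c, gcycle W c & size c = l.
Proof.
move=> nt degt lW.
have W0 : 0 < #|W| by move: lW; clear; lia.
have t0 : 0 < t by move: nt W0; clear; lia.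
have [|c gc lc] := long_cycle t0 degt W0; first by left; exact: ltnW.
have [|//|[L [_ le1 le2 H]]] := @exact_length W l #|W| lW.
  by exists c => //; move: lc; rewrite (minn_idPl (ltnW nt)).
have EL : L = #|W| by apply/eqP; rewrite eqn_leq le2.
have := vol_ge degt; move: H W0 nt; rewrite EL subnn mul0n addn0; clear.
by rewrite -!muln2; nia.
Qed.

(* The two bounds come from deleting vertices of minimum degree until [2k+2] vertices
   remain: the [i]-th last deleted vertex has degree at most [h + i], and at most [k]
   unless a subgraph of minimum degree [k+1] appears. *)
Lemma no_long_cycle_vol k W j : 0 < k -> #|W| = k.*2.+2 + j ->
  (forall c, gcycle W c -> size c < k.*2.+2) ->
  (exists h, [/\ 0 < h <= k, exists2 x, x \in W & dg W x <= h + j,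
     vol W <= 2 * (h * h) + (k.*2.+2 - h) * (k.*2.+1 - h) + 2 * (h * j) + j * j.+1
   & k <= h + j -> vol W + (k - h) * (k - h).-1 <=
       2 * (h * h) + (k.*2.+2 - h) * (k.*2.+1 - h) + 2 * (k * j)]) \/
  (exists i, [/\ 0 < i <= j & vol W + 2 * (k.+1 * (k + i)) <=
     (k.*2.+2 + i) * (k.*2.+1 + i) + 2 * (k * (j - i))]).
Proof.
move=> k0; elim: j W => [|j IHj] W cW noc.
  left; have [||h [S [h2 h0 SW cS dS]]] := @nonhamiltonian_low_degrees W.
  - by rewrite cW; move: k0; clear; lia.
  - by move=> c /noc; rewrite cW addn0; clear; lia.
  have hk : h <= k by move: h2; rewrite cW; clear; lia.
  (* The [h] vertices of [S] cost at most [2h] each; the remaining ones are at most complete. *)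
  have v1 : vol W <= 2 * (h * h) + (k.*2.+2 - h) * (k.*2.+1 - h).
    have sub : W :\: S \subset W by exact: subsetDl.
    have cC : #|W :\: S| = k.*2.+2 - h by rewrite cardsDS // cW cS addn0.
    have : vol W <= vol (W :\: S) + (#|W| - #|W :\: S|) * (2 * h).
      apply: vol_split_le => // x; rewrite setDDr setDv set0U => /setIP [_ xS].
      by rewrite mul2n -addnn leq_add ?dS // (leq_trans (dgS _ sub)) ?dS.
    move/leq_trans; apply; rewrite addnC leq_add //.
      rewrite cC cW; have -> : k.*2.+2 + 0 - (k.*2.+2 - h) = h by move: hk; clear; lia.
      by rewrite mulnCA.
    have := vol_le_complete (W :\: S); rewrite cC.
    by have -> : (k.*2.+2 - h).-1 = k.*2.+1 - h by move: hk; clear; lia.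
  exists h; split; rewrite ?h0 // ?muln0 ?addn0 //.
    by have [x xS] : exists x, x \in S; [apply/card_gt0P; rewrite cS | exists x; rewrite ?(subsetP SW) ?dS //].
  move=> kh; have -> : k - h = 0 by apply/eqP.
  by rewrite mul0n !(muln0, addn0).
have W0 : 0 < #|W| by rewrite cW.
have [v vW vmin] := min_dg W0.
have [dv|dv] := leqP (dg W v) k; last first.
  (* All degrees are at least [k + 1]. Enough volume for [long_cycle] at [t = k + 1] would give a
     cycle of length at least [2k + 2]. *)
  right; exists j.+1; split; first by rewrite leqnn.
  rewrite subnn muln0 addn0 leqNgt; apply/negP => dense.
  have [||c gc] := @long_cycle W k.+1 isT _ W0.
  - by move=> x xW; apply: leq_trans dv (vmin _ xW).
  - right; rewrite cW; move: dense.
    have -> : k.*2.+2 + j.+1 - 1 - k.+1 = k + j.+1 by clear; lia.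
    have -> : (k.*2.+2 + j.+1).-1 = k.*2.+1 + j.+1 by clear; lia.
    by rewrite -(mul2n k.+1) -mulnA.
  by have := noc _ gc; rewrite cW; clear; lia.
have sub : W :\ v \subset W by exact: subsetDl.
have cWv : #|W :\ v| = k.*2.+2 + j by move: cW; rewrite (cardsD1 v) vW addnS; case.
have nocv c : gcycle (W :\ v) c -> size c < k.*2.+2.
  by case=> uc cs cc; apply: noc; split => // x /cs; exact: (subsetP sub).
have := vol_del vW; case: (IHj _ cWv nocv) => [[h [hk [x xW dx] v1 v2]]|[i [ij vi]]] vE.
- left; exists h.
  have dv' : dg W v <= h + j.+1.
    have xW' := subsetP sub _ xW; apply: leq_trans (vmin _ xW') _.
    rewrite (dgU x sub) addnS -addn1 leq_add //.
    apply: leq_trans (dg_le_card (S := [set v]) _) _; last by rewrite cards1.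
    by move=> y; rewrite !inE negb_and negbK => /andP[/orP[//|/negbTE ->]].
  split => //; first by exists v.
    rewrite vE; move: v1 dv'; move: (2 * (h * h) + _) (vol _) => B vl.
    by rewrite -!muln2; clear; lia.
  move=> kh; rewrite vE.
  have [kj|kj] := leqP k (h + j).
    have := v2 kj; move: dv; move: (2 * (h * h) + _) (vol _) ((k - h) * _) => B vl xl.
    by rewrite -!muln2; clear; lia.
  (* Here the cap [k] takes over. The term [(k - h)(k - h - 1)] is what the smaller bounds [h + i]
     for [i <= k - h] save against [k], counted twice. *)
  have Ek : k = h + j.+1 by move: kh kj; clear; lia.
  have -> : k - h = j.+1 by move: Ek; clear; lia.
  move: v1 dv; move: (2 * (h * h) + _) (vol _) => B vl; rewrite Ek -!muln2 /=.
  by clear; lia.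
right; exists i; split; first by move: ij; clear; lia.
rewrite vE; have -> : j.+1 - i = (j - i).+1 by rewrite subSn //; case/andP: ij.
move: vi dv; move: (vol _) (_ * (_ + i)) ((_ + i) * _) => vl a b.
by rewrite -!muln2; clear; lia.
Qed.

(** With [|W| = 2k + d]: for [d > 2k] Dirac's condition holds; for [d = 2k] there is a spanning
    cycle on [4k] vertices; for [k < d < 2k] [long_cycle] applies directly; for [d <= k] the bounds
    of [no_long_cycle_vol] are contradicted. In the last two cases [exact_length] finishes. *)
Lemma dense_exact k W : 0 < k -> k.*2.+2 <= #|W| <= (4 * k).+1 ->
  (forall x, x \in W -> #|W| - k.*2 <= dg W x) ->
  k.*2 * k.*2.+1 + (#|W| - k.*2) * (#|W| - k.*2).-1 <= vol W ->
  exists2 c, gcycle W c & size c = k.*2.+2.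
Proof.
move=> k0 nk degd lo.
have [d Ed] : exists d, #|W| = k.*2 + d by exists (#|W| - k.*2); move: nk; clear; lia.
have Ed' : #|W| - k.*2 = d by rewrite Ed; clear; lia.
rewrite Ed' in degd lo.
have W0 : 0 < #|W| by move: nk; clear; lia.
have d2 : 1 < d by move: nk; rewrite Ed; clear; lia.
have d0 : 0 < d by exact: ltnW.
have l3 : 3 < k.*2.+2 by move: k0; clear; lia.
have [big|] := ltnP k.*2 d.
  apply: (dirac_exact (t := d)) => //; first by rewrite Ed; move: big; clear; lia.
  by rewrite l3; case/andP: nk.
rewrite leq_eqVlt => /orP[/eqP Edk|dk].
  have W4 : #|W| = 4 * k by rewrite Ed Edk; clear; lia.
  have [|c gc lc] := long_cycle d0 degd W0; first by left; rewrite W4 Edk; clear; lia.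
  have sc : size c = 4 * k.
    apply/eqP; rewrite eqn_leq -{1}W4 (gpath_size (gcycle_path gc)) /=.
    by apply: leq_trans lc; rewrite W4 Edk; clear; lia.
  have [k1|k1] := leqP k 1; first by exists c => //; rewrite sc; move: k1 k0; clear; lia.
  by apply: half_degree_cycle gc sc _ => // x xW; rewrite -Edk degd.
(* Length [2k + 2] starts Bondy's argument; [2d] is what [exact_length_arith] requires. *)
pose L0 := maxn k.*2.+2 d.*2.
have [c gc lc] : exists2 c, gcycle W c & L0 <= size c.
  have [kd|kd] := ltnP k d.
    have [|c gc lc] := long_cycle d0 degd W0.
      right; rewrite Ed; move: lo; set v := vol W.
      have [m Em] : exists m, k.*2 = d + m.+1 by exists (k.*2 - d).-1; move: dk; clear; lia.
      rewrite Em; have -> : d + m.+1 + d - 1 - d = d + m by clear; lia.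
      have hd : d * d = d * d.-1 + d by case: (d) => //= n; rewrite mulnS addnC.
      rewrite addnAC addnS /= -!muln2; move: hd; move: (d * d.-1) => d'.
      by clear; lia.
    exists c => //; apply: leq_trans lc; rewrite /L0 Ed.
    by move: d2 kd dk; clear; lia.
  apply: NNPP => no.
  have noc c : gcycle W c -> size c < k.*2.+2.
    move=> gc; rewrite ltnNge; apply/negP => le; apply: no; exists c => //.
    by rewrite geq_max le (leq_trans _ le) //; move: kd; clear; lia.
  have cW : #|W| = k.*2.+2 + (d - 2) by rewrite Ed; move: d2; clear; lia.
  have dk' : 1 < d <= k by rewrite d2.
  have [[h [hk [x xW dx] v1 v2]]|[i [ij vi]]] := no_long_cycle_vol k0 cW noc.
    apply: (no_long_cycle_arith _ dk' lo v1 v2).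
    by move: hk d2 (leq_trans (degd _ xW) dx); clear; lia.
  exact: large_core_arith ij dk' lo vi.
have [|||[L [lL L0L Ln up]]] // := @exact_length W k.*2.+2 L0.
- by rewrite l3 leq_maxl.
- by exists c.
case: (exact_length_arith (r := #|W| - L) dk _ _ lo up).
- by apply: leq_trans L0L; exact: leq_maxr.
- by rewrite subnKC.
Qed.

(** * Cliques and the extremal graph *)

Definition clique (K : {set T}) := forall x y, x \in K -> y \in K -> x != y -> e x y.

Lemma clique_path (K : {set T}) x s : clique K -> uniq (x :: s) ->
  {subset x :: s <= K} -> path e x s.
Proof.
move=> cK; elim: s x => //= y s IHs x /andP[xs /andP[ys us]] sK.
rewrite cK ?sK ?inE ?eqxx ?orbT //=; last first.
  by apply: contraNneq xs => ->; rewrite mem_head.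
rewrite IHs //= ?ys // => u us'; apply: sK; by rewrite inE us' orbT.
Qed.

(** Go from [p] to [q] through [m] vertices of [K], then return outside [K] along [r]. *)
Lemma clique_cycle W K p q m r z : clique K -> K \subset W -> p \in K -> q \in K -> p != q ->
  1 < m <= #|K| -> gpath W r -> 0 < size r -> (forall x, x \in r -> x \notin K) ->
  e (last z r) p -> e q (head z r) ->
  exists2 c, gcycle W c & size c = m + size r.
Proof.
move=> cK KW pK qK pq /andP[m1 mK] [ur rW pr] r0 rK elp eqh.
pose t := take (m - 2) (enum (K :\ p :\ q)).
have tE x : x \in t -> [/\ x != q, x != p & x \in K].
  by move/mem_take; rewrite mem_enum !inE => /and3P[].
have cKpq : #|K| = (#|K :\ p :\ q|).+2.
  by rewrite (cardsD1 p K) pK (cardsD1 q (K :\ p)) !inE qK eq_sym pq.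
have st : size t = m - 2.
  by rewrite size_takel // -cardE; move: mK; rewrite cKpq; clear; lia.
have ut : uniq t by rewrite take_uniq ?enum_uniq.
have us : uniq (p :: rcons t q).
  rewrite cons_uniq mem_rcons inE (negbTE pq) /= rcons_uniq ut andbT.
  by apply/andP; split; apply/negP => /tE[]; rewrite eqxx.
have sK : {subset p :: rcons t q <= K}.
  by move=> x; rewrite inE mem_rcons inE => /or3P[/eqP ->|/eqP ->|/tE[]].
exists ((p :: rcons t q) ++ r); last first.
  by rewrite size_cat /= size_rcons st; congr (_ + _); move: m1; clear; lia.
split.
- rewrite cat_uniq us ur andbT; apply/hasPn => x /rK; apply: contra; exact: sK.
- by move=> x; rewrite mem_cat => /orP[/sK /(subsetP KW)|/rW].
apply: (cycle_cat (z := z)) => //; last by rewrite /= last_rcons.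
exact: clique_path cK us sK.
Qed.

Lemma clique_attach W K v m : clique K -> K \subset W -> v \in W -> v \notin K ->
  1 < dg K v -> 1 < m <= #|K| -> exists2 c, gcycle W c & size c = m.+1.
Proof.
move=> cK KW vW vK /card_gt1P [p [q [pN qN pq]]] mK.
move: pN qN; rewrite !inE => /andP[pK ep] /andP[qK eq].
have gv : gpath W [:: v] by split => // x; rewrite inE => /eqP ->.
have vr x : x \in [:: v] -> x \notin K by rewrite inE => /eqP ->.
rewrite e_sym in eq.
have [c gc sc] := clique_cycle cK KW pK qK pq mK gv isT vr (ep : e (last v [:: v]) p) eq.
by exists c; rewrite // sc addn1.
Qed.

Lemma full_clique W : #|W| * (#|W|).-1 <= vol W -> clique W.
Proof.
move=> full x y xW yW xy; apply: contraT => nxy.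
have dx : dg W x < (#|W|).-1.
  have : dg W x <= #|(W :\ x) :\ y|.
    apply: dg_le_card => u uW exu; rewrite !inE uW andbT.
    by apply/andP; split; apply: contraNneq nxy => E; [rewrite -E | move: exu; rewrite E e_irr].
  by rewrite (cardsD1 x W) xW (cardsD1 y (W :\ x)) !inE eq_sym xy yW.
have : vol W < #|W| * (#|W|).-1; last by rewrite ltnNge full.
rewrite -sum_nat_const /vol (bigD1 x) //= [X in _ < X](bigD1 x) //=.
rewrite -addSn leq_add //; apply: leq_sum => u /andP[uW _].
by have := dg_lt uW; case: (#|W|).
Qed.

(** Two cliques sharing only [c], one on [2k + 1] vertices: the exceptional graph without vertex
    numbering, fit for adding a vertex. *)
Definition extremal k W := exists c, exists A B : {set T},
  [/\ W = c |: (A :|: B), #|A| = k.*2,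
      [/\ c \notin A, c \notin B & [disjoint A & B]],
      clique (c |: A) /\ clique (c |: B) &
      forall a b, a \in A -> b \in B -> ~~ e a b].

Lemma extremal_card c (A B : {set T}) : c \notin A -> c \notin B -> [disjoint A & B] ->
  #|c |: (A :|: B)| = (#|A| + #|B|).+1.
Proof.
move=> cA cB dAB; rewrite cardsU1 inE (negbTE cA) (negbTE cB) /= add1n.
by rewrite cardsU (disjoint_setI0 dAB) cards0 subn0.
Qed.

(** The extremal graph has no edge above the threshold. Hence a vertex added to it must have large
    degree, and a strict excess excludes it. *)
Lemma extremal_vol k W : extremal k W ->
  vol W <= k.*2 * k.*2.+1 + (#|W| - k.*2) * (#|W| - k.*2).-1.
Proof.
move=> [c [A [B [WE cA [ncA ncB dAB] [clA clB] nAB]]]].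
have cW := extremal_card ncA ncB dAB; rewrite -WE cA in cW.
have -> : #|W| - k.*2 = (#|B|).+1 by rewrite cW; clear; lia.
have dA a : a \in A -> dg W a <= k.*2.
  move=> aA; have : dg W a <= #|(c |: A) :\ a|.
    apply: dg_le_card => y; rewrite WE !inE => yW eay.
    rewrite (contraTneq _ eay) ?andTb => [|->]; last by rewrite e_irr.
    by case/or3P: yW => [->|->|/(nAB _ _ aA)]; rewrite ?orbT // eay.
  have := cardsD1 a (c |: A); rewrite cardsU1 ncA cA !inE aA orbT; clear; lia.
have dB b : b \in B -> dg W b <= #|B|.
  move=> bB; have : dg W b <= #|(c |: B) :\ b|.
    apply: dg_le_card => y; rewrite WE !inE => yW eby.
    rewrite (contraTneq _ eby) ?andTb => [|->]; last by rewrite e_irr.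
    by case/or3P: yW => [->|yA|->]; rewrite ?orbT //; move: (nAB _ _ yA bB); rewrite e_sym eby.
  have := cardsD1 b (c |: B); rewrite cardsU1 ncB !inE bB orbT; clear; lia.
have dc : dg W c <= k.*2 + #|B|.
  have cinW : c \in W by rewrite WE !inE eqxx.
  by have := dg_lt cinW; rewrite cW.
have eAB F : \sum_(x in A :|: B) F x = \sum_(x in A) F x + \sum_(x in B) F x.
  by rewrite -bigU //; apply: eq_bigl => x; rewrite !inE.
have -> : vol W = dg W c + (\sum_(x in A) dg W x + \sum_(x in B) dg W x).
  by rewrite -eAB /vol {1}WE big_setU1 // inE negb_or ncA.
have sA : \sum_(x in A) dg W x <= k.*2 * k.*2.
  by rewrite -{1}cA -sum_nat_const; apply: leq_sum.
have sB : \sum_(x in B) dg W x <= #|B| * #|B|.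
  by rewrite -sum_nat_const; apply: leq_sum.
move: sA sB dc; move: (\sum_(x in A) _) (\sum_(x in B) _) (dg W c) => u v w.
by rewrite -!muln2 /=; clear; lia.
Qed.


(** * Induction by deleting a vertex of minimum degree *)

(** The thresholds for orders up to and from [4k + 1] are equivalent at [4k + 1], so the induction
    passes from one to the other there. *)
Lemma even_cycle_or_extremal k W : 0 < k -> k.*2.+2 <= #|W| ->
  (#|W| <= (4 * k).+1 ->
    k.*2 * k.*2.+1 + (#|W| - k.*2) * (#|W| - k.*2).-1 <= vol W) ->
  ((4 * k).+1 <= #|W| -> #|W| * #|W| <= (vol W).*2.+1) ->
  (exists2 c, gcycle W c & size c = k.*2.+2) \/ #|W| <= (4 * k).+1 /\ extremal k W.
Proof.
move=> k0; have [n] := ubnP #|W|; elim: n W => // n IHn W lt_n nk small large.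
have W0 : 0 < #|W| by apply: leq_trans nk.
have [v vW vmin] := min_dg W0.
have sub : W :\ v \subset W by exact: subsetDl.
have cWv : #|W| = (#|W :\ v|).+1 by rewrite (cardsD1 v) vW.
have vE := vol_del vW.
have vNv : v \notin W :\ v by rewrite !inE eqxx.
have lift : (exists2 c, gcycle (W :\ v) c & size c = k.*2.+2) ->
    exists2 c, gcycle W c & size c = k.*2.+2.
  by case=> c [uc cs cc] sc; exists c => //; split => // x /cs /(subsetP sub).
have dgv : dg W v = dg (W :\ v) v.
  apply: eq_card => y; rewrite !inE; case: eqP => [->|] //=.
  by rewrite e_irr andbF.
have IH := IHn (W :\ v); rewrite -[X in X < n -> _]/(#|W :\ v|) in IH.
have {IH} IH := IH _; have ltn' : #|W :\ v| < n by move: lt_n; rewrite cWv.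
have {}IH := IH ltn'.
have [big|mid] := ltnP (4 * k).+1 #|W|.
  (* Either all degrees exceed half the order, or deleting [v] preserves the square threshold. *)
  have [half|half] := ltnP #|W| (dg W v).*2.
    left; apply: (dirac_exact half vmin).
    by rewrite nk andbT; move: k0; clear; lia.
  have sq := delete_parity (vol_even (W :\ v)) vE half W0 (large (ltnW big)).
  have sq' : #|W :\ v| * #|W :\ v| <= (vol (W :\ v)).*2.+1 by move: sq; rewrite cWv.
  have m1 : (4 * k).+1 <= #|W :\ v| by move: big; rewrite cWv.
  case: IH => [|le|_|/lift|[le ext]] //.
  - by move: m1 k0; clear; lia.
  - have E : #|W :\ v| = (4 * k).+1 by apply/eqP; rewrite eqn_leq le m1.
    move: sq'; rewrite E; have -> : (4 * k).+1 - k.*2 = k.*2.+1 by clear; lia.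
    by rewrite -!muln2 /=; clear; lia.
  - by left.
  (* [W] without [v] consists of two cliques on [2k + 1] vertices sharing [c]. As [v] has at least 3
     neighbours, two lie in one clique, and [v] extends it to a cycle of length [2k + 2]. *)
  left.
  have E : #|W :\ v| = (4 * k).+1 by apply/eqP; rewrite eqn_leq le m1.
  have up := extremal_vol ext.
  have dv : k.*2 < dg W v.
    have lo := large (ltnW big).
    move: up lo; rewrite vE cWv E; have -> : (4 * k).+1 - k.*2 = k.*2.+1 by clear; lia.
    by rewrite -!muln2 /=; clear; lia.
  have [c [A [B [WE cA [ncA ncB dAB] [clA clB] nAB]]]] := ext.
  have cW := extremal_card ncA ncB dAB; rewrite -WE cA E in cW.
  have cB : #|B| = k.*2 by move: cW; clear; lia.
  have sA : c |: A \subset W :\ v by rewrite WE setUS // subsetUl.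
  have sB : c |: B \subset W :\ v by rewrite WE setUS // subsetUr.
  have two : dg W v <= dg (c |: A) v + dg (c |: B) v.
    rewrite dgv WE /dg -cardsUI; apply: leq_trans (leq_addr _ _).
    apply: subset_leq_card; apply/subsetP => y; rewrite !inE => /andP[+ ->].
    by rewrite !andbT -orbA => /or3P[] ->; rewrite ?orbT.
  have kk : 1 < k.*2.+1 by move: k0; clear; lia.
  have [dA|dA] := ltnP 1 (dg (c |: A) v).
    apply: (clique_attach clA (subset_trans sA sub) vW _ dA).
      by apply: contra vNv; exact: (subsetP sA).
    by rewrite cardsU1 ncA cA kk leqnn.
  apply: (clique_attach clB (subset_trans sB sub) vW).
  - by apply: contra vNv; exact: (subsetP sB).
  - by move: two dv dA k0; clear; lia.
  by rewrite cardsU1 ncB cB kk leqnn.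
have {small large} lo := small mid.
have [dense|dv] := leqP (#|W| - k.*2) (dg W v).
  left; apply: dense_exact => //; first by rewrite nk.
  by move=> x xW; apply: leq_trans dense (vmin _ xW).
(* At order [2k + 2] the count forces [v] to have degree 1 and the rest to be complete: the extremal
   graph with second part [v] alone. *)
have [n2|n2] := leqP #|W| k.*2.+2.
  have E : #|W| = k.*2.+2 by apply/eqP; rewrite eqn_leq n2.
  have E' : #|W :\ v| = k.*2.+1 by move: E; rewrite cWv => -[].
  have d2 : k.*2.+2 - k.*2 = 2 by clear; lia.
  rewrite E d2 in lo dv.
  have up := vol_le_complete (W :\ v); rewrite E' /= in up.
  have dv1 : dg W v = 1.
    by move: lo up dv; rewrite vE -!muln2 /=; clear; lia.
  have cl : clique (W :\ v).
    by apply: full_clique; rewrite E' /=; move: lo; rewrite vE dv1 -!muln2 /=; clear; lia.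
  right; split => //.
  have /cards1P [c cE] : #|[set y in W | e v y]| == 1 by apply/eqP.
  have nbr y : y \in W -> e v y = (y == c).
    by move=> yW; move/setP/(_ y): cE; rewrite !inE yW.
  have cW : c \in W by move/setP/(_ c): cE; rewrite !inE eqxx => /andP[].
  have evc : e v c by rewrite nbr ?eqxx.
  have cv : c != v by apply: contraTneq evc => ->; rewrite e_irr.
  have cWv' : c \in W :\ v by rewrite !inE cv.
  exists c, (W :\ v :\ c), [set v]; rewrite setD1K //; split => //.
  - by rewrite setUA setD1K // setUC setD1K.
  - by move: E'; rewrite (cardsD1 c) cWv' => -[].
  - by rewrite !inE eqxx cv; split => //; rewrite disjoint_sym disjoints1 !inE eqxx andbF.
  - split=> // x y; rewrite !inE => /orP[]/eqP -> /orP[]/eqP ->; rewrite ?eqxx // => _.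
    by rewrite e_sym.
  move=> x y; rewrite !inE => /and3P[xc _ xW] /eqP ->.
  by rewrite e_sym nbr.
have nk' : k.*2.+2 <= #|W :\ v| by move: n2; rewrite cWv.
have d1 : #|W| - k.*2 = (#|W :\ v| - k.*2).+1 by rewrite cWv subSn //; move: nk'; clear; lia.
(* With [d = |W| - 2k] the threshold drops by [2(d - 1)], and [v] has degree at most [d - 1]. *)
have lo' : k.*2 * k.*2.+1 + (#|W :\ v| - k.*2) * (#|W :\ v| - k.*2).-1 <= vol (W :\ v).
  have [m Em] : exists m, #|W :\ v| - k.*2 = m.+1.
    by exists (#|W :\ v| - k.*2).-1; move: nk'; clear; lia.
  move: lo dv; rewrite vE d1 Em /=; move: (_ * k.*2.+1) (vol _) => a b.
  by rewrite -!muln2; clear; lia.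
case: IH => [//|//||/lift|[_ ext]].
- by move: mid; rewrite cWv; clear; lia.
- by left.
(* The count gives [v] at least [|B| + 1] neighbours. Two of them in the clique on [c] and [A] yield
   the cycle; otherwise [v] sees all of [B] and a single [u] of that clique. If [u = c], then [v]
   joins [B]. *)
have up := extremal_vol ext.
have dvE : (#|W :\ v| - k.*2) <= dg W v.
  have [m Em] : exists m, #|W :\ v| - k.*2 = m.+1.
    by exists (#|W :\ v| - k.*2).-1; move: nk'; clear; lia.
  move: lo up; rewrite vE d1 Em /=; move: (_ * k.*2.+1) (vol _) => a b.
  by rewrite -!muln2; clear; lia.
have [c [A [B [WE cA [ncA ncB dAB] [clA clB] nAB]]]] := ext.
have cW := extremal_card ncA ncB dAB; rewrite -WE cA in cW.
have {dvE} dvB : (#|B|).+1 <= dg W v by move: dvE; rewrite cW; clear; lia.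
have B0 : 0 < #|B| by move: nk'; rewrite cW; clear; lia.
have sA : c |: A \subset W :\ v by rewrite WE setUS // subsetUl.
have sAW := subset_trans sA sub.
have vA : v \notin c |: A by apply: contra vNv; exact: (subsetP sA).
have vB : v \notin B.
  by apply: contra vNv => vB; rewrite WE !inE vB !orbT.
have kk : 1 < k.*2.+1 by move: k0; clear; lia.
have [dA|dA] := ltnP 1 (dg (c |: A) v).
  left; apply: (clique_attach clA sAW vW vA dA).
  by rewrite cardsU1 ncA cA kk leqnn.
have WDA : W :\ v :\: (c |: A) = B.
  apply/setP => y; rewrite WE !inE negb_or.
  have [->|yc] := eqVneq y c; first by rewrite (negbTE ncB).
  by have [yA|yA] /= := boolP (y \in A); rewrite ?(disjointFr dAB yA).
have split_dg : dg W v = dg (c |: A) v + dg B v by rewrite dgv (dgU v sA) WDA.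
have dgB : dg B v = #|B|.
  by apply/eqP; rewrite eqn_leq dg_le /=; move: dvB dA; rewrite split_dg; clear; lia.
have dg1 : dg (c |: A) v = 1.
  by apply/eqP; rewrite eqn_leq dA /=; move: dvB; rewrite split_dg dgB; clear; lia.
have allB b : b \in B -> e v b.
  have /eqP/setP/(_ b) : [set y in B | e v y] == B.
    rewrite eqEcard; apply/andP; split; last by rewrite -/(dg B v) dgB.
    by apply/subsetP => y; rewrite inE => /andP[].
  by rewrite inE => + bB; rewrite bB.
have /cards1P [u uE] : #|[set y in c |: A | e v y]| == 1 by apply/eqP.
have nbr y : y \in c |: A -> e v y = (y == u).
  by move=> yA; move/setP/(_ y): uE; rewrite in_set1 in_set yA.
have uA : u \in c |: A by move/setP/(_ u): uE; rewrite in_set1 in_set eqxx => /andP[].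
have evu : e v u by rewrite nbr ?eqxx.
have WvE : W = c |: (A :|: (v |: B)).
  by rewrite -(setD1K vW) WE; apply/setP => y; rewrite !inE; do !case: (_ == _); do !case: (_ \in _).
have [uc|uc] := eqVneq u c.
  right; split => //; exists c, A, (v |: B); split => //.
  - split => //.
    + rewrite !inE negb_or ncB andbT; apply: contraNneq vA => <-.
      by rewrite !inE eqxx.
    + rewrite disjoint_sym disjoints_subset; apply/subsetP => y; rewrite !inE.
      case/orP => [/eqP ->|yB]; first by apply: contra vA => vA'; rewrite !inE vA' orbT.
      by move/disjointFl: dAB => ->.
  - split => // x y; rewrite setUCA !in_setU1.
    rewrite -!in_setU1; case/setU1P => [->|xB]; case/setU1P => [->|yB]; rewrite ?eqxx // => xy.
    + by case/setU1P: yB => [->|/allB //]; rewrite -uc.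
    + by rewrite e_sym; case/setU1P: xB => [->|/allB //]; rewrite -uc.
    + exact: clB.
  move=> a b aA; rewrite !inE => /orP[/eqP ->|bB]; last exact: nAB.
  rewrite e_sym nbr ?inE ?aA ?orbT // uc.
  by apply: contraTneq aA => ->.
(* Now [u] is in [A]: a path on [2k] vertices of the clique from [u] to [c] is closed through [b]
   and [v]. *)
left.
have [b bB] : exists b, b \in B by apply/card_gt0P.
have bWv : b \in W :\ v by rewrite WE !inE bB !orbT.
have bv : b != v by move: bWv; rewrite !inE => /andP[].
have gr : gpath W [:: b; v].
  split => /=; first by rewrite inE bv.
    by move=> y; rewrite !inE => /orP[]/eqP -> //; exact: (subsetP sub).
  by rewrite e_sym allB.
have bA : b \notin c |: A.
  rewrite !inE negb_or; apply/andP; split; first by apply: contraNneq ncB => <-.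
  by move/disjointFl: dAB => ->.
have rA y : y \in [:: b; v] -> y \notin c |: A.
  by rewrite !inE => /orP[]/eqP ->; rewrite -?in_setU1.
have ecb : e c b.
  apply: clB; rewrite ?inE ?eqxx ?bB ?orbT //.
  by apply: contraNneq ncB => ->.
have mK : 1 < k.*2 <= #|c |: A|.
  by rewrite cardsU1 ncA cA; move: k0; clear; lia.
have cK : c \in c |: A by rewrite !inE eqxx.
have [q gq sq] := clique_cycle (z := v) clA sAW uA cK uc mK gr isT rA evu ecb.
by exists q; rewrite // sq addn2.
Qed.

(** * Translation to the edge count, cycles and isomorphism of the statement *)

(** The volume counts ordered adjacent pairs, and over each edge lie both [(x, y)] and [(y, x)]. *)
Lemma num_edges_vol : (num_edges T e).*2 <= vol [set: T].
Proof.
pose P := [set p : T * T | e p.1 p.2].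
have -> : vol [set: T] = #|P|.
  have -> : vol [set: T] = \sum_(x : T) \sum_(y : T) e x y.
    rewrite /vol; apply: eq_big => x; rewrite ?inE // => _.
    rewrite /dg -sum1_card big_mkcond; apply: eq_bigr => y _.
    by rewrite !inE; case: (e x y).
  rewrite pair_big -sum1_card [RHS]big_mkcond; apply: eq_bigr => -[x y] _.
  by rewrite inE /=; case: (e x y).
rewrite /num_edges; set E := finset _.
pose f (p : T * T) := [set p.1; p.2].
have fE : f @: P \subset E.
  apply/subsetP => A /imsetP [[x y]]; rewrite inE /= => exy ->.
  by rewrite inE; apply/existsP; exists x; apply/existsP; exists y; rewrite eqxx.
rewrite -[#|P|]sum1_card (partition_big f (mem E)) /=; last first.
  by move=> p pP; apply: (subsetP fE); apply: imset_f.
rewrite -muln2 -sum_nat_const; apply: leq_sum => A; rewrite inE.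
case/existsP => x /existsP [y /andP[/eqP -> exy]].
have xy : x != y by apply: contraTneq exy => ->; rewrite e_irr.
rewrite (bigD1 (x, y)) /=; last by rewrite inE exy eqxx.
rewrite (bigD1 (y, x)) //= inE /= e_sym exy /f /= setUC eqxx /=.
by rewrite xpair_eqE eq_sym negb_and xy.
Qed.

Lemma gcycle_has_cycle W s : gcycle W s -> has_cycle T e (size s).
Proof.
move=> gs; have [us _ _] := gs; have [_ _ ps] := gcycle_path gs.
have [s0|s0] := posnP (size s).
  have emp (i : 'I_(size s)) : False by have := ltn_ord i; rewrite [X in _ < X]s0.
  by exists (fun i => False_rect T (emp i)); split => i; case: (emp i).
have [z _] : exists z, z \in s.
  by case: s s0 {gs us ps} => // z s _; exists z; rewrite mem_head.
exists (fun i : 'I_(size s) => nth z s i); split.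
  by move=> i j /eqP; rewrite nth_uniq // => /eqP /val_inj.
move=> i; have lt := ltn_ord i; rewrite /=.
have [lt1|le1] := ltnP i.+1 (size s).
  by rewrite modn_small //; exact: (elimT (sortedP z) ps).
have E : size s = i.+1 by apply/eqP; rewrite eqn_leq le1 lt.
have Ei : (i : nat) = (size s).-1 := esym (congr1 predn E).
by rewrite -E modnn Ei; apply (gcycle_close z gs).
Qed.

(** A vertex is sent to its index in the list [c], then [A], then [B], which matches the numbering
    in [extremal_rel]. *)
Lemma extremal_graph_iso k n : #|T| = n -> extremal k [set: T] ->
  graph_iso T e n (extremal_rel k n).
Proof.
move=> Tn [c [A [B [WE cA [ncA ncB dAB] [clA clB] nAB]]]].
pose s := c :: enum A ++ enum B.
have us : uniq s.
  rewrite /= mem_cat !mem_enum negb_or ncA ncB cat_uniq !enum_uniq /= andbT.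
  by apply/hasPn => x; rewrite !mem_enum => xB; rewrite (disjointFl dAB).
have sT x : x \in s.
  by have := in_setT x; rewrite WE !inE mem_cat !mem_enum.
have ss : size s = n.
  by rewrite -(card_uniqP us) -Tn; apply: eq_card => x; rewrite sT.
have lt x : index x s < n by rewrite -ss index_mem.
pose f x := Ordinal (lt x).
have idxA x : (index x s <= k.*2) = (x \in c |: A).
  have -> : (index x s <= k.*2) = (x \in take k.*2.+1 s) by rewrite in_take.
  by rewrite /= take_size_cat ?inE ?mem_enum // -cardE.
have idx0 x : (index x s == 0) = (x == c).
  by rewrite /= [x == c]eq_sym; case: (c == x).
have fI : injective f.
  move=> x y /(congr1 val) /= E; rewrite -(nth_index c (sT x)) -(nth_index c (sT y)).
  by congr (nth c s _); exact: E.
exists f; split; first by apply: inj_card_bij; rewrite ?card_ord ?Tn.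
move=> x y; rewrite /extremal_rel (inj_eq fI).
rewrite -[nat_of_ord (f x)]/(index x s) -[nat_of_ord (f y)]/(index y s).
rewrite !idx0 !idxA.
have [->|xy] /= := eqVneq x y; first by rewrite e_irr.
have cl u v : u \in c |: A = (v \in c |: A) -> u != v -> e u v.
  move=> uv; have [uA|uA] := boolP (u \in c |: A).
    by apply: clA; rewrite -?uv.
  have inB w : w \notin c |: A -> w \in c |: B.
    by have := in_setT w; rewrite WE !inE negb_or => /or3P[] ->; rewrite ?andbF ?orbT.
  by apply: clB; apply: inB; rewrite -?uv.
have inAB w : w != c -> (w \in A) || (w \in B).
  by move=> wc; have := in_setT w; rewrite WE !inE (negbTE wc).
have apex w : w != c -> e c w.
  by move=> wc; case/orP: (inAB w wc) => wI; [apply: clA | apply: clB];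
    rewrite ?inE ?eqxx ?wI ?orbT // eq_sym.
have [xc|xc] /= := eqVneq x c; first by rewrite xc apex // -xc eq_sym.
have [yc|yc] /= := eqVneq y c; first by rewrite yc e_sym apex.
have [E|] := eqVneq (x \in c |: A) (y \in c |: A); first by rewrite cl.
rewrite !inE (negbTE xc) (negbTE yc) /= => E; apply/esym/negbTE.
move: (inAB _ xc) (inAB _ yc) E.
have [xA _|xA /= xB] := boolP (x \in A); have [yA|yA /=] := boolP (y \in A) => //.
  by move=> yB _; exact: nAB.
by move=> _ _; rewrite e_sym; exact: nAB.
Qed.

End Graph.

(** * All even lengths up to [2k + 2] *)

Theorem theorem1p6 (k n : nat) (T : finType) (e : rel T) :
  symmetric e -> irreflexive e -> #|T| = n ->
  1 <= k -> k.*2 + 2 <= n -> n <= k.*2.*2 + 1 ->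
  'C(k.*2 + 1, 2) + 'C(n - k.*2, 2) <= num_edges T e ->
  ~ graph_iso T e n (extremal_rel k n) ->
  forall m, 2 <= m <= k + 1 -> has_cycle T e (m.*2).
Proof.
move=> e_sym e_irr Tn k1 nk kn dense niso m /andP[m2 mk].
have cT : #|[set: T]| = n by rewrite cardsT.
have vE := num_edges_vol e_sym e_irr.
have lo : k.*2 * k.*2.+1 + (n - k.*2) * (n - k.*2).-1 <= vol e [set: T].
  apply: leq_trans vE; apply: leq_trans (_ : ('C(k.*2 + 1, 2) + 'C(n - k.*2, 2)).*2 <= _); last by rewrite leq_double.
  have bin2 p : ('C(p, 2)).*2 = p * p.-1 by rewrite -mul2n -mul_bin_diag bin1.
  by rewrite doubleD !bin2 addn1 /= mulnC.
have [d Ed] : exists d, n = k.*2 + d by exists (n - k.*2); rewrite subnKC //; move: nk; clear; lia.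
have Ed' : n - k.*2 = d by rewrite Ed; clear; lia.
rewrite Ed' in lo.
have hd : d * d = d * d.-1 + d by case: (d) => //= p; rewrite mulnS addnC.
(* The length is [2q + 2], the top length for the parameter [q <= k]; [x] below is [k - q]. *)
case: m m2 mk => // q q1; rewrite addn1 ltnS => qk.
suff [c gc <-] : exists2 c, gcycle e [set: T] c & size c = q.+1.*2.
  exact: gcycle_has_cycle gc.
have [x Ex] : exists x, k = q + x by exists (k - q); rewrite subnKC.
have dk : d <= k.*2.+1 by move: kn; rewrite Ed; clear; lia.
have nq : n - q.*2 = d + x.*2 by rewrite Ed Ex; clear; lia.
(* The two sides differ by [4 x (2 q + 1 - d)] with [d + 2 x <= 2 q + 1]. *)
have gap : n <= (4 * q).+1 ->
    q.*2 * q.*2.+1 + (n - q.*2) * (n - q.*2).-1 + 8 * (x * x) <= vol e [set: T].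
  move=> nq4; apply: leq_trans lo; rewrite nq.
  have [w Ew] : exists w, q.*2.+1 = d + x.*2 + w.
    by exists (q.*2.+1 - (d + x.*2)); move: nq4; rewrite Ed Ex; clear; lia.
  have hdx : (d + x.*2) * (d + x.*2) = (d + x.*2) * (d + x.*2).-1 + (d + x.*2).
    by case: (d + x.*2) => //= p; rewrite mulnS addnC.
  rewrite Ex; move: hd hdx (congr1 (muln x) Ew) (leq0n (x * w)); rewrite -!muln2.
  by move: (d * d.-1) ((d + x * 2) * _.-1) => u v; clear; lia.
(* The slack is at least the square of [w = 2k + 1 - d]. *)
have square : n * n <= (vol e [set: T]).*2.+1.
  have [w Ew] : exists w, k.*2.+1 = d + w by exists (k.*2.+1 - d); rewrite subnKC.
  move: lo hd (leq0n (w * w)) (congr1 (muln k) Ew) (congr1 (muln d) Ew) (congr1 (muln w) Ew).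
  rewrite Ed -!muln2; move: (d * d.-1) => u.
  by move: Ew; clear; lia.
have [||||//|[le ext]] := @even_cycle_or_extremal T e e_sym e_irr q [set: T]; rewrite ?cT //.
- by move: nk; rewrite Ed Ex; move: qk; rewrite Ex; clear; lia.
- by move/gap; apply: leq_trans; rewrite leq_addr.
rewrite cT in le.
(* An extremal graph for [q] leaves no room for the excess [8 x^2], so [x = 0] and the graph is the
   excluded one. *)
have := leq_trans (gap le) (extremal_vol e_sym e_irr ext).
rewrite cT -[X in _ <= X]addn0 leq_add2l leqn0 muln_eq0 /= muln_eq0 orbb => /eqP x0.
case: niso; apply: extremal_graph_iso => //.
by rewrite Ex x0 addn0.
Qed.
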